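(* Let $t_1,\ldots,t_n\in\mathbb T$ be distinct points and let $w_1,\ldots,w_n\in\mathbb T$. Let $\gamma=\{\gamma_1,\ldots,\gamma_{n-1}\}$ be an admissible tuple, let $\theta^{\gamma}_{ij}$ be the entries of the $2\times 2$ rational matrix function $\Theta^\gamma$ and let $x_i,y_i$ ($i=1,\ldots,n-1$) be the numbers associated with $\gamma$ (all defined in the context). Let $$f_{\gamma}(z)=\frac{\theta^{\gamma}_{11}(z)w_n+\theta^{\gamma}_{12}(z)}{\theta^{\gamma}_{21}(z)w_n+\theta^{\gamma}_{22}(z)}.\qquad ( * )$$ Then: (1) $f_{\gamma}$ is a finite Blaschke product and satisfies $f_\gamma(t_i)=w_i$ for $i=1,\ldots,n$. (2) $|f_{\gamma}'(t_i)|\le \gamma_i$ for $i=1,\ldots,n-1$. Moreover, $|f_{\gamma}'(t_i)|=\gamma_i$ if and only if $x_iw_n\neq y_i$. (3) $\deg f_{\gamma}=n-1-\ell$, where $\ell=\#\{i\in\{1,\ldots,n-1\}: x_iw_n=y_i\}$. Conversely, every Blaschke product $f\in\mathcal B_{n-1}$ satisfying $f(t_i)=w_i$ for $i=1,\ldots,n$ admits a representation $( * )$, $f=f_\gamma$, for some admissible tuple $\gamma=\{\gamma_1,\ldots,\gamma_{n-1}\}$. This representation is unique (that is, the admissible tuple $\gamma$ with $f=f_\gamma$ is unique) if and only if $\deg f=n-1$.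
   Context: $\mathbb D$ is the open unit disk and $\mathbb T$ the unit circle in $\mathbb C$. A finite Blaschke product of degree $k$ is a function $f(z)=c\prod_{i=1}^k\frac{z-a_i}{1-z\overline{a}_i}$ with $|c|=1$, $|a_i|<1$ (unimodular constants have degree $0$). $\mathcal B_k$ is the set of all finite Blaschke products of degree at most $k$. Given distinct $t_1,\ldots,t_n\in\mathbb T$ and $w_1,\ldots,w_n\in\mathbb T$, a tuple $\gamma=\{\gamma_1,\ldots,\gamma_{n-1}\}$ of positive numbers (ordered) is called admissible if the $(n-1)\times(n-1)$ Hermitian matrix $P^{\gamma}_{n-1}=[p_{ij}]_{i,j=1}^{n-1}$ with $p_{ij}=\frac{1-w_i\overline{w}_j}{1-t_i\overline{t}_j}$ for $i\ne j$ and $p_{ii}=\gamma_i$ is positive definite. Let $T=\mathrm{diag}(t_1,\ldots,t_{n-1})$, $M=(w_1,\ldots,w_{n-1})^{\top}$, $E=(1,\ldots,1)^{\top}\in\mathbb C^{n-1}$, let $\mathbf e_i$ be the $i$-th column of the identity matrix $I_{n-1}$, and let $^*$ denote the conjugate transpose. For an admissible $\gamma$ define $$x_i=(1-t_n\overline{t}_i)\,\mathbf e_i^*(P^{\gamma}_{n-1})^{-1}(t_nI-T)^{-1}E,\qquad y_i=(1-t_n\overline{t}_i)\,\mathbf e_i^*(P^{\gamma}_{n-1})^{-1}(t_nI-T)^{-1}M$$ for $i=1,\ldots,n-1$, and $$\Theta^{\gamma}(z)=\begin{bmatrix}\theta^{\gamma}_{11}(z)&\theta^{\gamma}_{12}(z)\\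 \theta^{\gamma}_{21}(z)&\theta^{\gamma}_{22}(z)\end{bmatrix}=I_2+(z-t_n)\begin{bmatrix}E^*\\ M^*\end{bmatrix}(I-zT^* )^{-1}(P^{\gamma}_{n-1})^{-1}(t_nI-T)^{-1}\begin{bmatrix}E&-M\end{bmatrix}.$$ $f_\gamma$ is regarded as a rational function, so that removable singularities (in particular at the points $t_i$) are removed. *)

(* Defs.v *)
From HB Require Import structures.
From mathcomp Require Import all_boot all_order all_algebra.
From mathcomp Require Import generic_quotient.
From mathcomp Require Import complex.
From mathcomp Require Import all_classical all_reals all_analysis.

Set Implicit Arguments.
Unset Strict Implicit.
Unset Printing Implicit Defensive.

Import Order.TTheory GRing.Theory Num.Theory.
Import numFieldNormedType.Exports.

Local Open Scope ring_scope.
Local Open Scope sesquilinear_scope.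

(* Rational functions in one variable over C are the elements of the fraction
   field {fraction {poly C}}. *)
Section RationalFunctions.
Variable C : numClosedFieldType.
Local Notation "x %:F" := (FracField.tofrac x).
Implicit Types (f : {fraction {poly C}}) (p q : {poly C}) (z : C).

Definition ratX : {fraction {poly C}} := 'X%:F.

Definition ratC (c : C) : {fraction {poly C}} := c%:P%:F.

Definition rat_num f : {poly C} := (frac (repr f)).1.
Definition rat_den f : {poly C} := (frac (repr f)).2.

(* Value of f at z, read off a representation of f in lowest terms, so that
   removable singularities are removed; the value at a pole is the junk
   value 0. *)
Definition rat_eval f z : C :=
  let p := rat_num f in
  let q := rat_den f in
  let g := gcdp p q in
  (p %/ g).[z] / (q %/ g).[z].

Lemma frac_numden f : f = (rat_num f)%:F / (rat_den f)%:F.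
Proof.
rewrite -{1}[f]reprK /rat_num /rat_den; set x := repr f.
have d0 : (frac x).2%:F != 0 :> {fraction {poly C}}.
  by rewrite tofrac_eq0 denom_ratioP.
apply: (canRL (mulfK d0)); unlock FracField.tofrac.
rewrite -[LHS]FracField.pi_mul; apply/eqmodP => /=.
rewrite FracField.equivfE /FracField.mulf /=.
by rewrite !numden_Ratio ?mulr1 ?oner_neq0 ?denom_ratioP // mulrC.
Qed.

Lemma rat_evalE p q z :
  q.[z] != 0 -> rat_eval (p%:F / q%:F) z = p.[z] / q.[z].
Proof.
move=> qz0; rewrite /rat_eval /=; set f := (p%:F / q%:F).
have := frac_numden f; set n := rat_num f; set d := rat_den f => fE.
have d0 : d != 0 by exact: denom_ratioP.
have q0 : q != 0 by apply: contra_neq qz0 => ->; rewrite horner0.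
have ndE : p * d = n * q.
  move/eqP: fE; rewrite /f eqr_div ?tofrac_eq0 //.
  by rewrite -!tofracM tofrac_eq => /eqP.
set g := gcdp n d.
have g0 : g != 0 by rewrite gcdp_eq0 (negPf d0) andbF.
have nE : n = n %/ g * g by rewrite divpK // dvdp_gcdl.
have dE : d = d %/ g * g by rewrite divpK // dvdp_gcdr.
have redE : p * (d %/ g) = (n %/ g) * q.
  by apply: (mulIf g0); rewrite -mulrA -dE ndE {1}nE mulrAC.
have redEz := congr1 (horner^~ z) redE; rewrite !hornerM in redEz.
have cop : coprimep (n %/ g) (d %/ g).
  by rewrite coprimep_div_gcd // d0 orbT.
have dz0 : (d %/ g).[z] != 0.
  apply/negP => /eqP dz; move: redEz; rewrite dz mulr0 => /esym/eqP.
  rewrite mulf_eq0 (negPf qz0) orbF => nz.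
  by have := coprimep_root cop nz; rewrite dz eqxx.
by apply/eqP; rewrite eqr_div // redEz.
Qed.

Definition rat_deriv f z : C := derive1 (rat_eval f) z.

Definition is_blaschke (k : nat) f : Prop :=
  exists (c : C) (a : 'I_k -> C),
    [/\ `|c| = 1, (forall i, `|a i| < 1)
      & f = ratC c *
            \prod_(i < k) ((ratX - ratC (a i)) / (1 - ratX * ratC (a i)^*))].

Definition is_blaschke_le (k : nat) f : Prop :=
  exists2 j : nat, (j <= k)%N & is_blaschke j f.

Definition posdefmx (k : nat) (A : 'M[C]_k) : Prop :=
  A \is hermsymmx /\
  forall v : 'cV[C]_k, v != 0 -> 0 < (v ^t* *m A *m v) ord0 ord0.

End RationalFunctions.

(* There are m.+1 interpolation nodes, with m playing the role of n - 1: the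
   distinguished last node t_n is t ord_max, and the node t_i with i <= n - 1
   is t (lift ord_max i) for i : 'I_m. *)
Section Interpolation.
Variables (R : realType) (m : nat).
Local Notation C := (R[i]).
Variables (t w : 'I_m.+1 -> C) (gam : m.-tuple R).

Local Notation tn := (t ord_max).
Local Notation wn := (w ord_max).

Definition head_node (i : 'I_m) : 'I_m.+1 := lift ord_max i.

Definition Pgamma : 'M[C]_m :=
  \matrix_(i, j)
    if i == j then ((tnth gam i)%:C)%C
    else (1 - w (head_node i) * (w (head_node j))^*) /
         (1 - t (head_node i) * (t (head_node j))^*).

Definition admissible : Prop :=
  (forall i, 0 < tnth gam i) /\ posdefmx Pgamma.

Definition Tmx : 'M[C]_m := diag_mx (\row_i t (head_node i)).
Definition Mcol : 'cV[C]_m := \col_i w (head_node i).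
Definition Ecol : 'cV[C]_m := const_mx 1.

Definition xgamma (i : 'I_m) : C :=
  (1 - tn * (t (head_node i))^*) *
  (invmx Pgamma *m invmx (tn%:M - Tmx) *m Ecol) i ord0.

Definition ygamma (i : 'I_m) : C :=
  (1 - tn * (t (head_node i))^*) *
  (invmx Pgamma *m invmx (tn%:M - Tmx) *m Mcol) i ord0.

Definition Theta : 'M[{fraction {poly C}}]_2 :=
  1%:M +
  (ratX C - ratC tn) *:
    (map_mx (@ratC C) (col_mx (Ecol ^t*) (Mcol ^t*))
     *m invmx (1%:M - ratX C *: map_mx (@ratC C) (Tmx ^t*))
     *m map_mx (@ratC C)
          (invmx Pgamma *m invmx (tn%:M - Tmx) *m row_mx Ecol (- Mcol))).

Definition fgamma : {fraction {poly C}} :=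
  (Theta 0 0 * ratC wn + Theta 0 1) / (Theta 1 0 * ratC wn + Theta 1 1).

End Interpolation.

(* Main.v *)
Require Import Defs.
From HB Require Import structures.
From mathcomp Require Import all_boot all_order all_algebra.
From mathcomp Require Import complex.
From mathcomp Require Import all_classical all_reals all_analysis.
From mathcomp Require Import ring.

Import Order.TTheory GRing.Theory Num.Theory.
Local Open Scope ring_scope.

(** Write [P] for the Pick matrix of [gam], [u = P^-1 (tn - T)^-1 (wn E - M)],
    [S] for the support of [u], [k = #|S|], and [pi] for the product of the
    factors [1 - t_i^* z] with [i] in [S].  Up to a nonzero factor [u_i] is
    [x_i wn - y_i], so [k = m - l], and cancelling [pi] in the definition gives
    [f_gam = num / den] with

      [num = wn pi + (z - tn) sum_i V_i],
      [den = pi + (z - tn) sum_i w_i^* V_i],  [V_i = u_i pi / (1 - t_i^* z)],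

    polynomials of degree at most [k] ([fgamma_polys]).

    Put [H_i = (1 - tn t_i^* ) V_i].  The Stein equation
    [P_ij (1 - t_i t_j^* ) = 1 - w_i w_j^*] gives two identities, on which the
    direct part rests:

      [(z - t_i) (P H(z))_i = num(z) - w_i den(z)]            ([mxact_hvec]),
      [den(z) den(z')^* - num(z) num(z')^*
         = (1 - z z'^* ) <H(z'), H(z)>_P]                      ([hkernel]).

    The first contains the interpolation conditions, and it shows that
    [f'(t_i) = (P g)_i] with [g = H(t_i) / den(t_i)].  If [u_i != 0] then
    [g = t_i^* w_i e_i] and [|f'(t_i)| = gam_i].  If [u_i = 0] then
    [d = t_i^* w_i e_i - g] is nonzero, [P d] vanishes off [i], and
    [gam_i - |f'(t_i)| = <d, d>_P > 0] ([slope_supp], [slope_off]).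

    By the second identity and the positivity of [P], [num] and [den] have no
    common zero, the zeros of [num] lie in the disk and [num] has degree
    exactly [k]; the identity at [z' = 1 / z^*] says that [num] and [den] have
    the same modulus on the circle.  By reflection [den] is then, up to a
    constant, the denominator of the Blaschke product with the zeros of [num]
    ([reflected_denominator]), so [f_gam] is a Blaschke product of degree [k].

    Conversely let [f = p / q] be a Blaschke product of degree [k <= m] through
    all the nodes.  The kernel [(1 - f(z) f(z')^* ) / (1 - z z'^* )] is a sum of
    [k] terms [h(z) h(z')^*] ([blaschke_gram]).  Choose any set [S] of [k]
    nodes, let [gam_i] be the value of this kernel at [(t_i, t_i)] for [i] in
    [S], and that value plus some [delta > 0] otherwise.  The Pick matrix is
    positive semidefinite, and a vector on which its form vanishes is supported
    in [S] and makes the degree [k] polynomial [p] divide a polynomial of degree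
    less than [k], so it is zero and the matrix is positive definite
    ([grammx_pos]).  Lagrange interpolation writes [p] and [q], up to a common
    constant, as [num] and [den] for some [u] with support [S], and this [u]
    is the one attached to [gam] ([gram_representation]); so [f = f_gam].

    If [k < m], different values of [delta] give different tuples.  If [k = m],
    then [S] is everything for every representation, and [gam_i = |f'(t_i)|]
    is determined by [f]. *)

Set Implicit Arguments.
Unset Strict Implicit.
Unset Printing Implicit Defensive.

(** * Polynomials over the complex field and finite Blaschke products *)

Section PolynomialsAndBlaschkeProducts.
Variable C : numClosedFieldType.
Implicit Types (p q : {poly C}) (z a : C) (s : seq C).

Lemma norm1_conj z : z * z^* = 1 -> `|z| = 1.
Proof. by move=> zz; apply/eqP; rewrite -sqrp_eq1 // normCK zz. Qed.

Lemma poly_eq_horner p q : (forall z, p.[z] = q.[z]) -> p = q.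
Proof.
move=> pq; apply/eqP; rewrite -subr_eq0; apply/eqP.
set d := p - q; pose s := [seq i%:R : C | i <- iota 0 (size d)].
apply: (@roots_geq_poly_eq0 _ d s).
- by apply/allP => x _; rewrite rootE /d !hornerE pq subrr.
- rewrite map_inj_uniq ?iota_uniq // => i j /eqP.
  by rewrite eqr_nat => /eqP.
- by rewrite size_map size_iota.
Qed.

Lemma poly_eq_horner_neq a p q :
  (forall z, z != a -> p.[z] = q.[z]) -> p = q.
Proof.
move=> pq; apply: (@mulfI _ ('X - a%:P)); first by rewrite polyXsubC_eq0.
apply: poly_eq_horner => z; rewrite !hornerE.
by case: (eqVneq z a) => [->|/pq ->//]; rewrite subrr !mul0r.
Qed.

Lemma poly_eq_nodes (r : seq C) p q : uniq r ->
  (size p <= size r)%N -> (size q <= size r)%N ->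
  {in r, forall z, p.[z] = q.[z]} -> p = q.
Proof.
move=> rU sp sq pq; apply/eqP; rewrite -subr_eq0; apply/eqP.
apply: (@roots_geq_poly_eq0 _ (p - q) r) => //.
  by apply/allP => z /pq pqz; rewrite rootE !hornerE pqz subrr.
by apply: leq_trans (size_polyD _ _) _; rewrite size_polyN geq_max sp.
Qed.

Lemma dvdp_size_eq0 p q : p %| q -> (size q < size p)%N -> q = 0.
Proof.
move=> pq; apply: contraTeq => q0; rewrite -leqNgt; exact: dvdp_leq.
Qed.

(** The reflection [z ^ n (p (1 / z^* ))^*] of a polynomial [p] of degree at most
    [n]; the argument of [conjrev] is [n + 1]. *)
Definition conjrev (n : nat) p : {poly C} := \poly_(i < n) (p`_(n.-1 - i))^*.

Lemma horner_conjrev n p z : (size p <= n.+1)%N -> z != 0 ->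
  (conjrev n.+1 p).[z] = z ^+ n * (p.[(z^*)^-1])^*.
Proof.
move=> sp z0; rewrite /conjrev horner_poly (horner_coef_wide _ sp).
rewrite rmorph_sum mulr_sumr (reindex_inj rev_ord_inj) /=.
apply: eq_bigr => i _; rewrite subSS subKn -1?ltnS //.
rewrite rmorphM /= rmorphXn /= fmorphV /= conjCK mulrCA exprVn; congr (_ * _).
by rewrite expfB_cond // (negPf z0) add0n -ltnS ltn_ord.
Qed.

(** Numerator and denominator of the Blaschke product with zeros [s], repeated
    according to multiplicity. *)
Definition blnum s : {poly C} := \prod_(a <- s) ('X - a%:P).
Definition blden s : {poly C} := \prod_(a <- s) (1 - a^* *: 'X).

Definition in_disk s := all (fun a => `|a| < 1) s.

Lemma size_blnum s : size (blnum s) = (size s).+1.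
Proof. exact: size_prod_XsubC. Qed.

Lemma horner_blnum s z : (blnum s).[z] = \prod_(a <- s) (z - a).
Proof. by rewrite horner_prod; apply: eq_bigr => a _; rewrite !hornerE. Qed.

Lemma horner_blden s z : (blden s).[z] = \prod_(a <- s) (1 - a^* * z).
Proof. by rewrite horner_prod; apply: eq_bigr => a _; rewrite !hornerE. Qed.

Lemma blnum_root s z : in_disk s -> (blnum s).[z] = 0 -> `|z| < 1.
Proof.
move=> sD /eqP; rewrite -[_ == 0]/(root _ z) root_prod_XsubC => zs.
exact: (allP sD).
Qed.

Lemma blden_neq0 s z : in_disk s -> `|z| <= 1 -> (blden s).[z] != 0.
Proof.
move=> sD z1; rewrite horner_blden prodf_seq_neq0; apply/allP => a /(allP sD) /=.
move=> a1; rewrite subr_eq0; apply/negP => /eqP/(congr1 Num.norm) /esym.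
rewrite normrM norm_conjC normr1 => e; have : `|a| * `|z| < 1.
  by rewrite (le_lt_trans _ a1) // ler_piMr.
by rewrite e ltxx.
Qed.

Lemma blden_poly_neq0 s : in_disk s -> blden s != 0.
Proof.
move=> sD; apply: contraTneq (blden_neq0 (z := 0) sD _) => [->|].
  by rewrite horner0 eqxx.
by rewrite normr0.
Qed.

Lemma coprimep_blnum_blden s : in_disk s -> coprimep (blnum s) (blden s).
Proof.
move=> sD; apply/Pdiv.ClosedField.coprimepP => z /eqP/(blnum_root sD)/ltW.
exact: blden_neq0.
Qed.

Lemma size_blden s : (size (blden s) <= (size s).+1)%N.
Proof.
rewrite /blden; elim: s => [|a s IH]; first by rewrite big_nil size_poly1.
rewrite big_cons; apply: leq_trans (size_polyMleq _ _) _ => /=.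
have : (size (1 - a^* *: 'X : {poly C})%R <= 2)%N.
  apply: leq_trans (size_polyD _ _) _; rewrite size_poly1 geq_max /=.
  rewrite size_polyN; apply: leq_trans (size_scale_leq _ _) _.
  by rewrite size_polyX.
move: IH; set x := size _; set y := size _ => h1 h2.
by rewrite -subn1 leq_subLR addnC (leq_trans (leq_add h1 h2)) // addn2 add1n.
Qed.

Lemma conjrev_blnum s : conjrev (size s).+1 (blnum s) = blden s.
Proof.
apply: (@poly_eq_horner_neq 0) => z z0; rewrite horner_conjrev ?size_blnum //.
rewrite horner_blnum horner_blden rmorph_prod /=.
elim: s => [|a s IH]; first by rewrite !big_nil expr0 mulr1.
rewrite !big_cons exprS -IH rmorphB /= fmorphV /= conjCK mulrACA.
by congr (_ * _); rewrite mulrBr divff // mulrC.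
Qed.

(** A polynomial [p] of degree [n] with all its zeros in the disk, and a
    polynomial [q] prime to [p], of degree at most [n], such that [|p| = |q|] on
    the circle (the last hypothesis, in a form that makes sense off the circle),
    form a Blaschke product of degree [n]: the zeros of [p] divide the reflection
    of [q], and the degrees leave no room for anything else. *)
Lemma reflected_denominator (n : nat) p q :
  size p = n.+1 -> (size q <= n.+1)%N -> coprimep p q ->
  (forall z, p.[z] = 0 -> `|z| < 1) ->
  (forall z, z != 0 ->
     q.[z] * (q.[(z^*)^-1])^* = p.[z] * (p.[(z^*)^-1])^*) ->
  exists (c d : C) s, [/\ `|c| = 1, d != 0, size s = n /\ in_disk s,
     p = (c * d) *: blnum s & q = d *: blden s].
Proof.
move=> sp sq cpq proot refl.
have [s pE] := closed_field_poly_normal p; set l := lead_coef p in pE.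
have l0 : l != 0 by rewrite lead_coef_eq0 -size_poly_eq0 sp.
rewrite -/(blnum s) in pE.
have ss : size s = n.
  by move: sp; rewrite pE size_scale // size_blnum => -[].
have sD : in_disk s.
  apply/allP => a sa; apply: proot; apply/eqP.
  by rewrite pE hornerZ mulf_eq0 -[X in _ || X]/(root _ a) root_prod_XsubC sa orbT.
have sp' : (size p <= n.+1)%N by rewrite sp.
have reflE : q * conjrev n.+1 q = p * conjrev n.+1 p.
  apply: (@poly_eq_horner_neq 0) => z z0; rewrite !hornerM !horner_conjrev //.
  by rewrite !(mulrCA _ (z ^+ n)) refl.
have crp : conjrev n.+1 p = l^* *: blden s.
  rewrite -conjrev_blnum ss pE; apply/polyP => i.
  by rewrite coefZ !coef_poly; case: ifP; rewrite ?mulr0 // coefZ rmorphM.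
have bD0 := blden_poly_neq0 sD.
have bN0 : blnum s != 0 by rewrite -size_poly_eq0 size_blnum.
have lc0 : l^* != 0 by rewrite conjC_eq0.
have prodE : q * conjrev n.+1 q = blnum s * ((l * l^*) *: blden s).
  by rewrite reflE crp pE -!mul_polyC polyCM; ring.
have cop : coprimep (blnum s) q by rewrite -(coprimepZl _ _ l0) -pE.
have : blnum s %| conjrev n.+1 q.
  by rewrite -(Gauss_dvdpr _ cop) prodE dvdp_mulr.
case/dvdpP => r rE.
have r0 : r != 0.
  apply: contraNneq bN0 => r0; move/eqP: prodE.
  rewrite rE r0 mul0r mulr0 eq_sym mulf_eq0 scaler_eq0 (negPf bD0) mulf_eq0.
  by rewrite (negPf l0) (negPf lc0) !orbF.
have /size1_polyC rC : (size r <= 1)%N.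
  have : (size (conjrev n.+1 q) <= n.+1)%N by exact: size_poly.
  rewrite rE size_mul // size_blnum ss addnS /=.
  by rewrite -[X in (_ <= X)%N -> _]add1n leq_add2r.
set e := r`_0 in rC; have e0 : e != 0 by rewrite -polyC_eq0 -rC.
have qE : q = (l * l^* / e) *: blden s.
  apply: (mulfI bN0); apply: (mulfI r0).
  have -> : r * (blnum s * ((l * l^* / e) *: blden s)) =
            blnum s * ((l * l^*) *: blden s).
    by rewrite mulrCA rC mul_polyC scalerA [e * _]mulrC divfK.
  by rewrite -prodE rE; ring.
have d0 : l * l^* / e != 0 by rewrite !mulf_neq0 ?invr_neq0.
have cd : e / l^* * (l * l^* / e) = l by field; rewrite e0 lc0.
move: (l * l^* / e) qE d0 cd => d qE d0 cd.
have b1 : (blden s).[1] = ((blnum s).[1])^*.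
  rewrite -conjrev_blnum horner_conjrev ?size_blnum ?oner_neq0 //.
  by rewrite expr1n mul1r conjC1 invr1.
have N1 : `|(blnum s).[1]| != 0.
  by rewrite normr_eq0; apply/eqP => /(blnum_root sD); rewrite normr1 ltxx.
have dl : `|d| = `|l|.
  have /eqP := refl 1 (oner_neq0 _).
  rewrite conjC1 invr1 -!normCK qE [in X in _ == X]pE !hornerZ b1.
  rewrite !normrM norm_conjC eqrXn2 ?mulr_ge0 // => /eqP.
  exact: (mulIf N1).
exists (e / l^*), d, s; split => //; last by rewrite cd.
have /(congr1 Num.norm) := cd; rewrite normrM dl -[RHS]mul1r.
by apply: mulIf; rewrite normr_eq0.
Qed.

(** The kernel [(1 - f(z) f(z')^* ) / (1 - z z'^* )] of a Blaschke product [f] is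
    a finite sum of terms [h(z) h(z')^*], with denominators cleared.  Adding the
    zero [a] to [f] adds the term with [h = sqrt (1 - |a|^2) f / (1 - a^* z)]. *)
Lemma blaschke_gram s : in_disk s -> exists r : seq {poly C}, forall z z',
  (blden s).[z] * (blden s).[z']^* - (blnum s).[z] * (blnum s).[z']^* =
  (1 - z * z'^*) * \sum_(g <- r) g.[z] * g.[z']^*.
Proof.
elim: s => [_|a s IH /= /andP[a1 /IH[r rE]]].
  exists [::] => z z'; rewrite /blden /blnum !big_nil mulr0 !hornerE.
  by rewrite conjC1 ?mulr1 subrr.
pose e := sqrtC (1 - `|a| ^+ 2); have ee : e * e^* = 1 - a * a^*.
  by rewrite -normCK ger0_norm ?sqrtC_ge0 ?sqrtCK ?normCK // -?normCK subr_ge0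
     expr_le1 // ltW.
exists (e *: blnum s :: [seq (1 - a^* *: 'X) * g | g <- r]) => z z'.
rewrite big_cons big_map mulrDr hornerZ [in RHS]hornerZ rmorphM /=.
have -> : \sum_(g <- r) ((1 - a^* *: 'X) * g).[z] * ((1 - a^* *: 'X) * g).[z']^* =
  (1 - a^* * z) * (1 - a * z'^*) * \sum_(g <- r) g.[z] * g.[z']^*.
  rewrite mulr_sumr; apply: eq_bigr => g _; rewrite !hornerE /=.
  by rewrite !(rmorphM, rmorphB, rmorph1) /= conjCK; ring.
rewrite [X in _ = _ + X]mulrCA -rE.
have -> : (blden (a :: s)) = (1 - a^* *: 'X) * blden s by rewrite /blden big_cons.
have -> : (blnum (a :: s)) = ('X - a%:P) * blnum s by rewrite /blnum big_cons.
rewrite !hornerM !(hornerD, hornerN, hornerZ, hornerX, hornerC).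
rewrite !(rmorphM, rmorphB, rmorph1) /= conjCK.
set b := (blnum s).[z]; set b' := ((blnum s).[z'])^*.
have -> : (1 - z * z'^*) * (e * b * (e^* * b')) =
          (1 - z * z'^*) * (e * e^*) * b * b' by ring.
rewrite ee; ring.
Qed.

End PolynomialsAndBlaschkeProducts.

(** * The resolvent and kernel identities *)

Section Resolvent.
Variables (C : numClosedFieldType) (m : nat).
Variables (t w u : 'I_m -> C) (tn wn : C) (P : 'M[C]_m).

(** The vector [P x]; vectors are functions on the index type. *)
Definition mxact (x : 'I_m -> C) (i : 'I_m) : C := \sum_j P i j * x j.

(** The form [x^* P y]. *)
Definition mxform (x y : 'I_m -> C) : C := \sum_i (x i)^* * mxact y i.

(** Positive definiteness of [P], witnessed by a nonzero entry of the vector. *)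
Definition pos_form := forall x i, x i != 0 -> 0 < mxform x x.

Hypothesis tnU : tn * tn^* = 1.
Hypothesis wnU : wn * wn^* = 1.
Hypothesis stein : forall i j,
  P i j * (1 - t i * (t j)^*) = 1 - w i * (w j)^*.
Hypothesis Pherm : forall i j, P j i = (P i j)^*.
Hypothesis Pu : forall i, mxact u i * (tn - t i) = wn - w i.

(** The quantities [H], [num] and [den], computed at the point [al / be] of the
    projective line: at a finite point [z] take [al = z] and [be = 1], at
    infinity [al = 1] and [be = 0].  The number [rho] stands for the value of
    the common denominator. *)
Definition hvec (V : 'I_m -> C) i := (1 - tn * (t i)^*) * V i.
Definition hnum rho al be (V : 'I_m -> C) :=
  wn * rho + (al - tn * be) * \sum_i V i.
Definition hden rho al be (V : 'I_m -> C) :=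
  rho + (al - tn * be) * \sum_i (w i)^* * V i.

(** [V] is a multiple of the resolvent [(1 - z T^* )^-1 u] with denominators
    cleared: [V_i = rho u_i / (be - al t_i^* )]. *)
Definition resolves rho al be (V : 'I_m -> C) :=
  forall i, (be - al * (t i)^*) * V i = rho * u i.

(** Termwise, the Stein equation turns [(al - be t_i) P_ij H_j] into a combination
    of [V_j] and [P_ij u_j]. *)
Lemma mxact_hvec rho al be V i : resolves rho al be V ->
  (al - be * t i) * mxact (hvec V) i =
    hnum rho al be V - w i * hden rho al be V.
Proof.
move=> resV; pose F j := (al - be * tn) * ((1 - w i * (w j)^*) * V j) +
  (tn - t i) * (P i j * (rho * u j)).
have -> : (al - be * t i) * mxact (hvec V) i = \sum_j F j.
  rewrite mulr_sumr; apply: eq_bigr => j _.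
  by rewrite /F -stein -resV /hvec; ring.
rewrite big_split -!mulr_sumr /=.
have -> : \sum_j P i j * (rho * u j) = rho * mxact u i.
  by rewrite mulr_sumr; apply: eq_bigr => j _; ring.
have -> : \sum_j (1 - w i * (w j)^*) * V j =
          \sum_j V j - w i * \sum_j (w j)^* * V j.
  by rewrite mulr_sumr -sumrB; apply: eq_bigr => j _; ring.
rewrite mulrCA [_ * mxact _ _]mulrC Pu /hnum /hden; ring.
Qed.

Lemma mxform_herm x y : mxform x y = (mxform y x)^*.
Proof.
rewrite /mxform rmorph_sum /=.
under eq_bigr do rewrite mulr_sumr.
rewrite exchange_big /=; apply: eq_bigr => j _.
rewrite rmorphM /= conjCK /mxact rmorph_sum mulr_sumr /=.
by apply: eq_bigr => i _; rewrite rmorphM /= -Pherm; ring.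
Qed.

(** The kernel identity, polarized.  It follows from [mxact_hvec] by writing
    [be be'^* - al al'^*] as
    [be (be'^* - al'^* t_j) - al'^* (al - be t_j)]. *)
Lemma hkernel rho al be V rho' al' be' V' :
  resolves rho al be V -> resolves rho' al' be' V' ->
  (be * be'^* - al * al'^*) * mxform (hvec V') (hvec V) =
    hden rho al be V * (hden rho' al' be' V')^* -
    hnum rho al be V * (hnum rho' al' be' V')^*.
Proof.
move=> resV resV'; set X := mxact (hvec V).
set p := hnum rho al be V; set q := hden rho al be V.
pose s := \sum_j V j; pose r := \sum_j (w j)^* * V j.
pose s' := \sum_j V' j; pose r' := \sum_j (w j)^* * V' j.
pose F j := - (al'^* - tn^* * be'^*) * ((p - w j * q) * (V' j)^*) +
   rho'^* * (be - tn^* * al) * ((u j)^* * X j).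
have -> : (be * be'^* - al * al'^*) * mxform (hvec V') (hvec V) = \sum_j F j.
  rewrite mulr_sumr; apply: eq_bigr => j _; rewrite /F -/X -mxact_hvec // -/X.
  have /(congr1 (fun x : C => x^*)) := resV' j => /=.
  rewrite /hvec !(rmorphM, rmorphB) /= !conjCK ?rmorph1.
  move=> e; set c := (u j)^*; set v := (V' j)^* in e *.
  have -> : rho'^* * (be - tn^* * al) * (c * X j) =
            (be - tn^* * al) * (rho'^* * c * X j) by ring.
  by rewrite -e; ring.
rewrite big_split -!mulr_sumr /=.
have -> : \sum_j (p - w j * q) * (V' j)^* = p * s'^* - q * r'^*.
  rewrite !rmorph_sum !mulr_sumr -sumrB; apply: eq_bigr => j _ /=.
  by rewrite rmorphM /= conjCK; ring.
have -> : \sum_j (u j)^* * X j = tn * (wn^* * s - r).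
  rewrite -[LHS]/(mxform u (hvec V)) mxform_herm rmorph_sum /=.
  rewrite mulrBr !mulr_sumr -sumrB; apply: eq_bigr => j _ /=.
  have /(congr1 (fun x : C => x^*)) := Pu j => /=.
  rewrite !(rmorphM, rmorphB) /= conjCK => e.
  rewrite [RHS](_ : _ = tn * (wn^* - (w j)^*) * V j); last by ring.
  by rewrite -e /hvec !conjCK; ring: tnU.
rewrite /p /q /hnum /hden !(rmorphM, rmorphD, rmorphB) /= -/s -/r -/s' -/r'.
by ring: tnU wnU.
Qed.

End Resolvent.

(** * Numerator and denominator polynomials attached to a vector *)

Section NodePolynomials.
Variables (C : numClosedFieldType) (m : nat) (t : 'I_m -> C).
Hypothesis t_inj : injective t.
Hypothesis tU : forall i, t i * (t i)^* = 1.
Implicit Types (A S : {set 'I_m}) (z : C).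

(** The product of the factors [1 - t_i^* z], which vanish at the nodes in [A]. *)
Definition nodepoly A : {poly C} := \prod_(i in A) (1 - (t i)^* *: 'X).

Lemma horner_nodepoly A z : (nodepoly A).[z] = \prod_(i in A) (1 - z * (t i)^*).
Proof.
by rewrite horner_prod; apply: eq_bigr => i _; rewrite !hornerE mulrC.
Qed.

Lemma node_factor_eq0 z i : (1 - z * (t i)^* == 0) = (z == t i).
Proof.
apply/idP/eqP => [|->]; last by rewrite tU subrr.
by rewrite subr_eq0 => /eqP e; rewrite -[z]mulr1 -(tU i) mulrCA -e mulr1.
Qed.

Lemma nodepoly_neq0 A z :
  (forall i, i \in A -> z != t i) -> (nodepoly A).[z] != 0.
Proof.
move=> zA; rewrite horner_nodepoly; apply/prodf_neq0 => i iA.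
by rewrite node_factor_eq0 zA.
Qed.

Lemma nodepoly_root A i : i \in A -> (nodepoly A).[t i] = 0.
Proof. by move=> iA; rewrite horner_nodepoly (bigD1 i) //= tU subrr mul0r. Qed.

Lemma nodepolyD1 A i z : i \in A ->
  (1 - z * (t i)^*) * (nodepoly (A :\ i)).[z] = (nodepoly A).[z].
Proof.
move=> iA; rewrite !horner_nodepoly [RHS](bigD1 i) //=; congr (_ * _).
by apply: eq_bigl => j; rewrite !inE andbC.
Qed.

Lemma nodepolyD1_root A i j : j != i -> j \in A -> (nodepoly (A :\ i)).[t j] = 0.
Proof. by move=> ji jA; rewrite nodepoly_root // !inE ji. Qed.

Lemma nodepolyD1_neq0 A i : (nodepoly (A :\ i)).[t i] != 0.
Proof.
apply: nodepoly_neq0 => j; rewrite !inE => /andP[ji _].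
by apply: contra ji => /eqP/t_inj->.
Qed.

Lemma size_node_factor i : size (1 - (t i)^* *: 'X : {poly C})%R = 2.
Proof.
have ti0 : - (t i)^* != 0.
  by apply/eqP => e; have := tU i; rewrite -[_^*]opprK e oppr0 mulr0 => /eqP;
     rewrite eq_sym oner_eq0.
by rewrite addrC -scaleNr size_polyDl ?size_scale ?size_polyX ?size_poly1.
Qed.

Lemma lead_coef_node_factor i : lead_coef (1 - (t i)^* *: 'X : {poly C}) = - (t i)^*.
Proof.
rewrite lead_coefE size_node_factor /= coefB coefZ coefX coef1 /=.
by rewrite mulr1 sub0r.
Qed.

Lemma size_nodepoly A : size (nodepoly A) = #|A|.+1.
Proof.
rewrite size_prod => [|i _]; last by rewrite -size_poly_eq0 size_node_factor.
rewrite (eq_bigr (fun=> 2)) => [|i _]; last exact: size_node_factor.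
by rewrite sum_nat_const muln2 -addnn -addSn addnK.
Qed.

Lemma coef_nodepoly A : (nodepoly A)`_#|A| = \prod_(i in A) (- (t i)^*).
Proof.
rewrite -[X in _`_X]/(#|A|.+1.-1) -size_nodepoly -lead_coefE lead_coef_prod.
by apply: eq_bigr => i _; rewrite lead_coef_node_factor.
Qed.

Variables (w u : 'I_m -> C) (tn wn : C) (S : {set 'I_m}).

(** The polynomials [u_i prod_(j in S, j != i) (1 - t_j^* z)] and the numerator
    and denominator of the associated rational function. *)
Definition vpoly i : {poly C} := u i *: nodepoly (S :\ i).
Definition numpoly : {poly C} :=
  wn *: nodepoly S + ('X - tn%:P) * \sum_i vpoly i.
Definition denpoly : {poly C} :=
  nodepoly S + ('X - tn%:P) * \sum_i (w i)^* *: vpoly i.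

Lemma horner_numpoly z : numpoly.[z] =
  hnum tn wn (nodepoly S).[z] z 1 (fun i => (vpoly i).[z]).
Proof. by rewrite /numpoly /hnum !hornerE ?mulr1 horner_sum. Qed.

Lemma horner_denpoly z : denpoly.[z] =
  hden w tn (nodepoly S).[z] z 1 (fun i => (vpoly i).[z]).
Proof.
rewrite /denpoly /hden !hornerE ?mulr1 horner_sum; congr (_ + _ * _).
by apply: eq_bigr => i _; rewrite hornerZ.
Qed.

Lemma horner_vpoly z i : (vpoly i).[z] = u i * (nodepoly (S :\ i)).[z].
Proof. by rewrite hornerZ. Qed.

Hypothesis uS : forall i, i \notin S -> u i = 0.

Lemma vpoly_resolves z :
  resolves t u (nodepoly S).[z] z 1 (fun i => (vpoly i).[z]).
Proof.
move=> i; rewrite horner_vpoly; case: (boolP (i \in S)) => [iS|/uS->].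
  by rewrite -(nodepolyD1 z iS); ring.
by rewrite !(mul0r, mulr0).
Qed.

Lemma size_vpoly i : (size (vpoly i) <= #|S|)%N.
Proof.
case: (boolP (i \in S)) => [iS|/uS]; last first.
  by rewrite /vpoly => ->; rewrite scale0r size_poly0.
apply: leq_trans (size_scale_leq _ _) _.
by rewrite size_nodepoly (cardsD1 i S) iS.
Qed.

Lemma size_vsum (c : 'I_m -> C) : (size (\sum_i c i *: vpoly i)%R <= #|S|)%N.
Proof.
apply: leq_trans (size_sum _ _ _) _; apply/bigmax_leqP => i _.
exact: leq_trans (size_scale_leq _ _) (size_vpoly i).
Qed.

Lemma size_XsubC_mul (p : {poly C}) (n : nat) : (size p <= n)%N ->
  (size (('X - tn%:P) * p)%R <= n.+1)%N.
Proof.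
move=> pn; apply: leq_trans (size_polyMleq _ _) _.
by rewrite size_XsubC.
Qed.

Lemma size_numpoly : (size numpoly <= #|S|.+1)%N.
Proof.
apply: leq_trans (size_polyD _ _) _; rewrite geq_max; apply/andP; split.
  by rewrite (leq_trans (size_scale_leq _ _)) // size_nodepoly.
apply: size_XsubC_mul; rewrite (eq_bigr (fun i => 1 *: vpoly i)).
  exact: (size_vsum (fun=> 1)).
by move=> i _; rewrite scale1r.
Qed.

Lemma size_denpoly : (size denpoly <= #|S|.+1)%N.
Proof.
apply: leq_trans (size_polyD _ _) _; rewrite geq_max size_nodepoly leqnn.
exact/size_XsubC_mul/size_vsum.
Qed.

Lemma coef_XsubC_mul (p : {poly C}) n : (size p <= n)%N ->
  (('X - tn%:P) * p)`_n = p`_n.-1.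
Proof.
move=> pn; rewrite mulrBl coefB coefXM coefCM [p`_n]nth_default // mulr0 subr0.
by case: n pn => // /[!leqn0]/[!size_poly_eq0]/eqP->; rewrite coef0.
Qed.

(** The coefficients of degree [#|S|] are the values at infinity of the
    homogeneous expressions. *)
Lemma coef_numpoly : numpoly`_#|S| =
  hnum tn wn (nodepoly S)`_#|S| 1 0 (fun i => (vpoly i)`_#|S|.-1).
Proof.
rewrite /numpoly /hnum coefD coefZ mulr0 subr0 mul1r coef_XsubC_mul ?coef_sum //.
rewrite (eq_bigr (fun i => 1 *: vpoly i)); first exact: (size_vsum (fun=> 1)).
by move=> i _; rewrite scale1r.
Qed.

Lemma coef_denpoly : denpoly`_#|S| =
  hden w tn (nodepoly S)`_#|S| 1 0 (fun i => (vpoly i)`_#|S|.-1).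
Proof.
rewrite /denpoly /hden coefD mulr0 subr0 mul1r coef_XsubC_mul ?size_vsum //.
by rewrite coef_sum; congr (_ + _); apply: eq_bigr => i _; rewrite coefZ.
Qed.

Lemma vpoly_coef_resolves :
  resolves t u (nodepoly S)`_#|S| 1 0 (fun i => (vpoly i)`_#|S|.-1).
Proof.
move=> i; rewrite /vpoly coefZ; case: (boolP (i \in S)) => [iS|/uS->].
  have e : #|S|.-1 = #|S :\ i| by rewrite (cardsD1 i S) iS.
  rewrite e !coef_nodepoly (bigD1 i iS) /=.
  rewrite (eq_bigl (fun j => (j \in S) && (j != i))) => [|j]; first by ring.
  by rewrite !inE andbC.
by rewrite !(mul0r, mulr0).
Qed.

Lemma vpoly_coef_neq0 i : i \in S -> u i != 0 -> (vpoly i)`_#|S|.-1 != 0.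
Proof.
move=> iS ui; have e : #|S|.-1 = #|S :\ i| by rewrite (cardsD1 i S) iS.
rewrite /vpoly coefZ e coef_nodepoly mulf_neq0 //; apply/prodf_neq0 => j _.
rewrite oppr_eq0 conjC_eq0; apply/eqP => tj0; have := tU j.
by rewrite tj0 mul0r => /eqP; rewrite eq_sym oner_eq0.
Qed.

Lemma denpoly_node i : i \in S ->
  denpoly.[t i] = (t i - tn) * ((w i)^* * (vpoly i).[t i]).
Proof.
move=> iS; rewrite horner_denpoly /hden nodepoly_root // mulr1 add0r; congr (_ * _).
rewrite (bigD1 i) //= big1 ?addr0 // => j ji; rewrite horner_vpoly.
by rewrite nodepolyD1_root ?mulr0 // eq_sym.
Qed.

Lemma numpoly_node i : i \in S ->
  numpoly.[t i] = (t i - tn) * (vpoly i).[t i].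
Proof.
move=> iS; rewrite horner_numpoly /hnum nodepoly_root // mulr1 mulr0 add0r.
congr (_ * _).
rewrite (bigD1 i) //= big1 ?addr0 // => j ji; rewrite horner_vpoly.
by rewrite nodepolyD1_root ?mulr0 // eq_sym.
Qed.

Lemma numpoly_tn : numpoly.[tn] = wn * (nodepoly S).[tn].
Proof. by rewrite /numpoly !hornerE subrr mul0r addr0. Qed.

Lemma denpoly_tn : denpoly.[tn] = (nodepoly S).[tn].
Proof. by rewrite /denpoly !hornerE subrr mul0r addr0. Qed.

End NodePolynomials.

(** * Interpolants defined by a positive definite Pick matrix *)

Section Forward.
Variables (C : numClosedFieldType) (m : nat).
Variables (t w u : 'I_m -> C) (tn wn : C) (P : 'M[C]_m).
Hypothesis t_inj : injective t.
Hypothesis tU : forall i, t i * (t i)^* = 1.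
Hypothesis wU : forall i, w i * (w i)^* = 1.
Hypothesis tnU : tn * tn^* = 1.
Hypothesis wnU : wn * wn^* = 1.
Hypothesis tnt : forall i, tn != t i.
Hypothesis stein : forall i j,
  P i j * (1 - t i * (t j)^*) = 1 - w i * (w j)^*.
Hypothesis Pherm : forall i j, P j i = (P i j)^*.
Hypothesis Ppos : pos_form P.
Hypothesis Pu : forall i, mxact P u i * (tn - t i) = wn - w i.

(* S is the full support of u, so that no factor of nodepoly is superfluous. *)
Let S : {set 'I_m} := [set i | u i != 0].
Let p := numpoly t u tn wn S.
Let q := denpoly t w u tn S.
Let V i := vpoly t u S i.
Let h i : {poly C} := (1 - tn * (t i)^*) *: V i.

Let uS i : i \notin S -> u i = 0.
Proof. by rewrite inE negbK => /eqP. Qed.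

Let hvecE z : hvec t tn (fun i => (V i).[z]) =1 (fun i => (h i).[z]).
Proof. by move=> i; rewrite hornerZ. Qed.

Lemma eq_mxact x y : x =1 y -> mxact P x =1 mxact P y.
Proof. by move=> xy i; apply: eq_bigr => j _; rewrite xy. Qed.

Lemma eq_mxform x y x' y' : x =1 y -> x' =1 y' -> mxform P x x' = mxform P y y'.
Proof. by move=> xy xy'; apply: eq_bigr => i _; rewrite xy (eq_mxact xy'). Qed.

Definition slope_poly i : {poly C} := \sum_j P i j *: h j.

Lemma horner_slope_poly i z :
  (slope_poly i).[z] = mxact P (fun j => (h j).[z]) i.
Proof. by rewrite horner_sum; apply: eq_bigr => j _; rewrite hornerZ. Qed.

(** The function [slope_poly i] is the difference quotient of [p - w i *: q] at
    the node [t i], where that polynomial vanishes. *)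
Lemma resolvent_horner i z :
  (z - t i) * (slope_poly i).[z] = p.[z] - w i * q.[z].
Proof.
have := mxact_hvec (rho := (nodepoly t S).[z]) stein Pu i (vpoly_resolves t uS z).
rewrite -horner_numpoly -horner_denpoly mul1r => <-; congr (_ * _).
by rewrite horner_slope_poly (eq_mxact (hvecE z)).
Qed.

Lemma kernel_poly z z' :
  (1 - z * z'^*) * mxform P (fun i => (h i).[z']) (fun i => (h i).[z]) =
    q.[z] * q.[z']^* - p.[z] * p.[z']^*.
Proof.
have := hkernel tnU wnU stein Pherm Pu (vpoly_resolves t uS z)
          (vpoly_resolves t uS z').
rewrite -!horner_numpoly -!horner_denpoly conjC1 mulr1 -/p -/q => <-.
by congr (_ * _); apply: eq_mxform => i; rewrite hvecE.
Qed.

Lemma mxform_ge0 x : 0 <= mxform P x x.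
Proof.
have [[i xi]|x0] := pselect (exists i, x i != 0); first exact/ltW/(Ppos xi).
rewrite /mxform big1 // => i _; case: (eqVneq (x i) 0) => [->|xi].
  by rewrite conjC0 mul0r.
by case: x0; exists i.
Qed.

Lemma node_factor_tn_neq0 i : 1 - tn * (t i)^* != 0.
Proof. by rewrite node_factor_eq0. Qed.

(** The vector [H(z)] has no zero: at a node [t i] of the support its entry [i]
    survives, elsewhere every entry of the support does. *)
Lemma hpoly_neq0 z i0 : i0 \in S -> exists i, (h i).[z] != 0.
Proof.
move=> i0S; have hi i : i \in S -> (nodepoly t (S :\ i)).[z] != 0 ->
  (h i).[z] != 0.
  rewrite inE => ui zi; rewrite hornerZ mulf_neq0 ?node_factor_tn_neq0 //.
  by rewrite horner_vpoly mulf_neq0.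
have [[i iS zE]|zS] := pselect (exists2 i, i \in S & z = t i).
  by exists i; apply: hi => //; rewrite zE nodepolyD1_neq0.
exists i0; apply: hi => //; apply: nodepoly_neq0 => // j; rewrite !inE.
by move=> /andP[_ jS]; apply/eqP => zE; case: zS; exists j; rewrite ?inE.
Qed.

Lemma hform_gt0 z i0 : i0 \in S ->
  0 < mxform P (fun i => (h i).[z]) (fun i => (h i).[z]).
Proof.
by move=> i0S; have [i hi] := hpoly_neq0 z i0S; apply: (Ppos (i := i)).
Qed.

(** At a common zero [z] the kernel identity gives
    [(1 - y z^* ) <H(z), H(y)> = 0] for all [y], hence [<H(z), H(z)> = 0]; this
    also covers points of the circle, where the identity at [(z, z)] is void. *)
Lemma numden_no_common_root i0 z : i0 \in S -> q.[z] = 0 -> p.[z] = 0 -> False.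
Proof.
move=> i0S qz pz; have := hform_gt0 z i0S.
pose g := \sum_i (h i).[z]^* *: \sum_j P i j *: h j.
have gE y : g.[y] = mxform P (fun i => (h i).[z]) (fun i => (h i).[y]).
  rewrite horner_sum; apply: eq_bigr => i _; rewrite hornerZ; congr (_ * _).
  by rewrite horner_sum; apply: eq_bigr => j _; rewrite hornerZ.
have g0 : g = 0.
  have : (1 - z^* *: 'X) * g = 0.
    apply: poly_eq_horner => y; rewrite hornerM gE horner0.
    rewrite hornerD hornerN hornerZ hornerX hornerC [z^* * _]mulrC.
    by rewrite kernel_poly qz pz conjC0 !mulr0 subrr.
  move/eqP; rewrite mulf_eq0 => /orP[/eqP e|/eqP //].
  have /= := congr1 (horner^~ 0) e; rewrite !hornerE ?mulr0 ?subr0 => /eqP.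
  by rewrite oner_eq0.
by rewrite -gE g0 horner0 ltxx.
Qed.

Lemma numpoly_root_disk i0 z : i0 \in S -> p.[z] = 0 -> `|z| < 1.
Proof.
move=> i0S pz; case: (real_ltP (normr_real z) (@real1 C)) => // z1.
have := kernel_poly z z; rewrite -!normCK pz normr0 expr0n subr0 => e.
have : `|q.[z]| ^+ 2 <= 0.
  by rewrite -e mulr_le0_ge0 ?mxform_ge0 // subr_le0 expr_ge1.
move=> le0; case: (numden_no_common_root i0S _ pz).
by apply/eqP; rewrite -normr_eq0 -sqrf_eq0 eq_le le0 exprn_ge0.
Qed.

(** The kernel identity at infinity shows that the top coefficient is nonzero. *)
Lemma size_numpoly_supp i0 : i0 \in S -> size p = #|S|.+1.
Proof.
move=> i0S; apply/eqP; rewrite eqn_leq size_numpoly // ltnNge.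
apply/negP => /leq_sizeP/(_ _ (leqnn _)) pk.
have := hkernel tnU wnU stein Pherm Pu (vpoly_coef_resolves tU uS)
          (vpoly_coef_resolves tU uS).
rewrite -coef_numpoly // -coef_denpoly // -/p -/q pk !mul0r subr0 conjC1.
rewrite ?mul0r mulr1 sub0r mulN1r -normCK => e.
have : 0 < mxform P (hvec t tn (fun i => (vpoly t u S i)`_#|S|.-1))
                    (hvec t tn (fun i => (vpoly t u S i)`_#|S|.-1)).
  apply: (Ppos (i := i0)); rewrite /hvec mulf_neq0 ?node_factor_tn_neq0 //.
  by apply: vpoly_coef_neq0 => //; rewrite inE in i0S.
by rewrite -oppr_lt0 e => /lt_geF; rewrite exprn_ge0.
Qed.

(** The two polynomials form a Blaschke product of degree [#|S|]. *)
Lemma forward_blaschke : exists (c d : C) s, [/\ `|c| = 1, d != 0,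
  size s = #|S| /\ in_disk s, p = (c * d) *: blnum s & q = d *: blden s].
Proof.
have [S0|[i0 i0S]] := set_0Vmem S.
  exists wn, 1, [::]; rewrite S0 cards0 oner_neq0; split => //.
  - exact: norm1_conj (wnU).
  - rewrite /p /numpoly /nodepoly S0 big_set0 /blnum big_nil big1 ?mulr0 ?addr0 ?mulr1 //.
    by move=> i _; rewrite /vpoly uS ?scale0r // S0 inE.
  - rewrite /q /denpoly /nodepoly S0 big_set0 /blden big_nil big1 ?mulr0 ?addr0 ?scale1r //.
    by move=> i _; rewrite /vpoly uS ?scale0r ?scaler0 // S0 inE.
apply: reflected_denominator.
- exact: size_numpoly_supp i0S.
- exact: size_denpoly.
- apply/Pdiv.ClosedField.coprimepP => z /eqP pz; apply/eqP => qz.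
  exact: numden_no_common_root i0S qz pz.
- by move=> z; apply: numpoly_root_disk i0S.
- move=> z z0; apply/eqP; rewrite -subr_eq0 -kernel_poly.
  by rewrite fmorphV /= conjCK divff // subrr mul0r.
Qed.

Lemma numpoly_interp i : p.[t i] = w i * q.[t i].
Proof.
apply/eqP; rewrite -subr_eq0; apply/eqP.
by rewrite -resolvent_horner subrr mul0r.
Qed.

Lemma norm_t i : `|t i| = 1.
Proof. exact: norm1_conj (tU i). Qed.

Lemma denpoly_unit_neq0 z : `|z| = 1 -> q.[z] != 0.
Proof.
move=> z1; have [c [d [s [_ d0 [_ sD] _ ->]]]] := forward_blaschke.
by rewrite hornerZ mulf_neq0 // blden_neq0 // z1.
Qed.

(** The derivative of [p / q] at the node [t i]. *)
Definition slope i := (slope_poly i).[t i] / q.[t i].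

Lemma slopeE i : slope i = mxact P (fun j => (h j).[t i] / q.[t i]) i.
Proof.
rewrite /slope horner_slope_poly mulr_suml; apply: eq_bigr => j _.
by rewrite mulrA.
Qed.

Lemma slope_supp i : u i != 0 -> slope i = (t i)^* * w i * P i i.
Proof.
move=> ui; have iS : i \in S by rewrite inE.
have q0 : q.[t i] != 0 by rewrite denpoly_unit_neq0 ?norm_t.
rewrite slopeE /mxact (bigD1 i) //= big1 ?addr0 => [|j ji]; last first.
  rewrite hornerZ horner_vpoly; case: (boolP (j \in S)) => [jS|/uS->].
    by rewrite nodepolyD1_root // 1?eq_sym // !(mulr0, mul0r).
  by rewrite !(mulr0, mul0r).
rewrite mulrC; congr (_ * _); apply: (mulIf q0); rewrite divfK //.
rewrite /q denpoly_node // hornerZ.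
rewrite -/(V i) [RHS](_ : _ = (t i)^* * (t i - tn) * (w i * (w i)^*) * (V i).[t i]).
  by rewrite wU mulr1 mulrBr [_ * t i]mulrC tU [_ * tn]mulrC.
by ring.
Qed.

(** With [g = H(t i) / q(t i)], the vectors [P g] and [P (t_i^* w_i e_i)] agree
    off the entry [i]. *)
Lemma mxact_slope_off i j : j != i ->
  mxact P (fun k => (h k).[t i] / q.[t i]) j = P j i * ((t i)^* * w i).
Proof.
move=> ji; have q0 : q.[t i] != 0 by rewrite denpoly_unit_neq0 ?norm_t.
have tij : t i - t j != 0.
  by rewrite subr_eq0; apply: contra ji => /eqP/t_inj->.
apply: (mulfI tij); apply: (mulIf q0).
have -> : (t i - t j) * mxact P (fun k => (h k).[t i] / q.[t i]) j * q.[t i] =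
          w i * q.[t i] - w j * q.[t i].
  rewrite -numpoly_interp -resolvent_horner horner_slope_poly -mulrA mulr_suml.
  by congr (_ * _); apply: eq_bigr => k _; rewrite -mulrA divfK.
rewrite -mulrBl; congr (_ * _).
have -> : w i - w j = w i * (1 - w j * (w i)^*) by rewrite mulrBr mulrCA wU !mulr1.
rewrite -stein.
have -> : t i - t j = t i * (1 - t j * (t i)^*) by rewrite mulrBr mulrCA tU !mulr1.
by ring: (tU i).
Qed.

(** The gap between the two sides is [<d, d>_P] with [d = t_i^* w_i e_i - g]. *)
Lemma slope_off i : u i = 0 -> `|slope i| < P i i.
Proof.
move=> ui; pose g j := (h j).[t i] / q.[t i]; pose k := (t i)^* * w i.
have kk : k * k^* = 1.
  by rewrite /k rmorphM /= conjCK; ring: (tU i) (wU i).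
have k0 : k != 0.
  by apply/eqP => e; move/eqP: kk; rewrite e mul0r eq_sym oner_eq0.
have gi : g i = 0 by rewrite /g hornerZ horner_vpoly ui !(mul0r, mulr0).
pose d j := (if j == i then k else 0) - g j.
have dE j : mxact P d j = P j i * k - mxact P g j.
  have -> : P j i * k = \sum_l P j l * (if l == i then k else 0).
    by rewrite (bigD1 i) //= eqxx big1 ?addr0 // => l /negPf->; rewrite mulr0.
  by rewrite -sumrB; apply: eq_bigr => l _; rewrite mulrBr.
have dpos : 0 < P i i - k^* * slope i.
  have : 0 < mxform P d d by apply: (Ppos (i := i)); rewrite /d eqxx gi subr0.
  rewrite /mxform (bigD1 i) //= big1 ?addr0 => [|j ji].
    rewrite dE /d eqxx gi subr0 -slopeE mulrBr mulrCA [k^* * k]mulrC kk mulr1 //.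
  by rewrite dE mxact_slope_off // subrr mulr0.
have spos : 0 <= k^* * slope i.
  have := mxform_ge0 g; rewrite [mxform P g g](_ : _ = k * (slope i)^*) => [|].
    by rewrite -conjC_ge0 rmorphM /= conjCK.
  rewrite slopeE -/g /mxact rmorph_sum mulr_sumr /=; apply: eq_bigr => j _.
  rewrite -/(mxact P g j) [(P i j * _)^*]rmorphM /= -Pherm; case: (eqVneq j i) => [->|ji].
    by rewrite gi conjC0 !(mul0r, mulr0).
  by rewrite mxact_slope_off // -/k; ring.
have k1 : `|k| = 1 := norm1_conj kk.
by rewrite -[`|_|]mul1r -k1 -norm_conjC -normrM ger0_norm // -subr_gt0.
Qed.

End Forward.

(** * Pick matrices of a given Blaschke product *)

Section Converse.
Variables (C : numClosedFieldType) (m : nat).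
Variables (t w : 'I_m -> C) (tn wn : C) (p q : {poly C}) (r : seq {poly C}).
Variables (S : {set 'I_m}) (delta : C).
Hypothesis t_inj : injective t.
Hypothesis tU : forall i, t i * (t i)^* = 1.
Hypothesis wU : forall i, w i * (w i)^* = 1.
Hypothesis tnt : forall i, tn != t i.
Hypothesis sp : size p = #|S|.+1.
Hypothesis sq : (size q <= #|S|.+1)%N.
Hypothesis cpq : coprimep p q.
Hypothesis qt : forall i, q.[t i] != 0.
Hypothesis qtn : q.[tn] != 0.
Hypothesis pt : forall i, p.[t i] = w i * q.[t i].
Hypothesis ptn : p.[tn] = wn * q.[tn].
Hypothesis gram : forall z z', q.[z] * q.[z']^* - p.[z] * p.[z']^* =
  (1 - z * z'^*) * \sum_(g <- r) g.[z] * g.[z']^*.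
Hypothesis delta_gt0 : 0 < delta.

(** The entries of the Gram vectors of the kernel of [p / q] at the nodes. *)
Definition feat (g : {poly C}) i := g.[t i] / q.[t i].

(** The Pick matrix of [p / q] at the nodes, with [delta] added to the diagonal
    entries outside [S]. *)
Definition grammx : 'M[C]_m := \matrix_(i, j)
  (\sum_(g <- r) feat g i * (feat g j)^* +
   if (i == j) && (i \notin S) then delta else 0).
Local Notation P := grammx.

Let proj (x : 'I_m -> C) g := \sum_j (feat g j)^* * x j.

Lemma grammx_stein i j : P i j * (1 - t i * (t j)^*) = 1 - w i * (w j)^*.
Proof.
case: (eqVneq i j) => [->|ij]; first by rewrite tU wU !subrr mulr0.
rewrite mxE (negPf ij) addr0 mulrC; apply: (mulfI (qt i)).
have qj : (q.[t j])^* != 0 by rewrite conjC_eq0.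
apply: (mulfI qj).
have -> : (q.[t j])^* * (q.[t i] * (1 - w i * (w j)^*)) =
  q.[t i] * (q.[t j])^* - p.[t i] * (p.[t j])^*.
  by rewrite !pt rmorphM /=; ring.
rewrite gram !(mulrCA _ (1 - t i * (t j)^*)); congr (_ * _).
rewrite !mulr_sumr; apply: eq_bigr => g _.
by rewrite /feat rmorphM fmorphV /=; field; rewrite qj qt.
Qed.

Lemma mxact_grammx x i :
  mxact P x i = \sum_(g <- r) feat g i * proj x g +
    (if i \notin S then delta * x i else 0).
Proof.
rewrite /mxact; under eq_bigr do rewrite mxE mulrDl.
rewrite big_split /=; congr (_ + _).
  under eq_bigr do rewrite mulr_suml.
  rewrite exchange_big /=; apply: eq_bigr => g _; rewrite mulr_sumr.
  by apply: eq_bigr => j _; rewrite mulrA.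
rewrite (bigD1 i) //= eqxx big1 ?addr0 /= => [|j ji].
  by case: ifP; rewrite ?mul0r.
by rewrite eq_sym (negPf ji) mul0r.
Qed.

Lemma mxform_grammx x : mxform P x x =
  \sum_(g <- r) `|proj x g| ^+ 2 + \sum_(i | i \notin S) delta * `|x i| ^+ 2.
Proof.
rewrite /mxform; under eq_bigr do rewrite mxact_grammx mulrDr.
rewrite big_split /= [X in _ = _ + X]big_mkcond; congr (_ + _).
  under eq_bigr do rewrite mulr_sumr.
  rewrite exchange_big /=; apply: eq_bigr => g _.
  rewrite normCKC /proj rmorph_sum mulr_suml /=; apply: eq_bigr => i _.
  by rewrite rmorphM /= conjCK mulrCA mulrA.
apply: eq_bigr => i _; case: ifP; rewrite ?mulr0 // => _.
by rewrite mulrCA normCKC.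
Qed.

(** For a vector [x] supported in [S], pairing the kernel with [x] gives a
    polynomial identity between [q], [p] and the sums that occur in [numpoly] and
    [denpoly]. *)
Lemma gram_interp x : (forall i, i \notin S -> x i = 0) ->
  (\sum_i vpoly t x S i) * q - (\sum_i (w i)^* *: vpoly t x S i) * p =
  nodepoly t S * \sum_(g <- r) proj x g *: g.
Proof.
move=> xS; apply: poly_eq_horner => z; rewrite !hornerE !horner_sum.
rewrite !mulr_suml -sumrB.
have -> : (nodepoly t S).[z] * \sum_(g <- r) (proj x g *: g).[z] =
  \sum_i ((nodepoly t S).[z] * x i) * \sum_(g <- r) g.[z] * (feat g i)^*.
  under [in RHS]eq_bigr do rewrite mulr_sumr.
  rewrite exchange_big mulr_sumr /=; apply: eq_bigr => g _.
  rewrite hornerZ /proj mulr_suml mulr_sumr; apply: eq_bigr => i _; ring.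
apply: eq_bigr => i _; rewrite -(vpoly_resolves t xS z i).
have qi : (q.[t i])^* != 0 by rewrite conjC_eq0.
apply: (mulfI qi).
have -> : (q.[t i])^* * ((1 - z * (t i)^*) * (vpoly t x S i).[z] *
    \sum_(g <- r) g.[z] * (feat g i)^*) =
  (vpoly t x S i).[z] * ((1 - z * (t i)^*) * \sum_(g <- r) g.[z] * (g.[t i])^*).
  have -> : \sum_(g <- r) g.[z] * (g.[t i])^* =
            (q.[t i])^* * \sum_(g <- r) g.[z] * (feat g i)^*.
    rewrite mulr_sumr; apply: eq_bigr => g _.
    by rewrite /feat rmorphM fmorphV /=; field.
  by ring.
by rewrite -gram pt [((w i)^* *: _).[z]]hornerZ rmorphM /=; ring.
Qed.

(** If the form vanishes at [x], then [x] is supported in [S] and [gram_interp]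
    makes [p] divide [\sum_i vpoly t x S i], whose degree is smaller; so [x] is
    zero. *)
Lemma grammx_pos : pos_form P.
Proof.
move=> x i xi; rewrite mxform_grammx lt_def.
have A0 : 0 <= \sum_(g <- r) `|proj x g| ^+ 2.
  by apply: sumr_ge0 => g _; rewrite exprn_ge0.
have B0 : 0 <= \sum_(j | j \notin S) delta * `|x j| ^+ 2.
  by apply: sumr_ge0 => j _; rewrite mulr_ge0 ?exprn_ge0 // ltW.
rewrite addr_ge0 // andbT paddr_eq0 //; apply/negP => /andP[/eqP A /eqP B].
have xS j : j \notin S -> x j = 0.
  move=> jS; have := psumr_eq0P _ B jS => /(_ _)/eqP; rewrite mulf_eq0.
  rewrite sqrf_eq0 normr_eq0 (gt_eqF delta_gt0) /= => e; apply/eqP/e.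
  by move=> k _; rewrite mulr_ge0 ?exprn_ge0 // ltW.
have px0 : \sum_(g <- r) proj x g *: g = 0.
  rewrite big_seq big1 // => g gr; move/eqP: A; rewrite psumr_eq0 => [|k _].
    by move/allP => /(_ g gr) /=; rewrite sqrf_eq0 normr_eq0 => /eqP->; rewrite scale0r.
  by rewrite exprn_ge0.
have := gram_interp xS; rewrite px0 mulr0 => /eqP; rewrite subr_eq0 => /eqP e.
have : p %| (\sum_j vpoly t x S j) * q by rewrite e dvdp_mull.
rewrite Gauss_dvdpl // => /dvdp_size_eq0 v0.
have iS : i \in S by apply: contraNT xi => /xS->.
have {}v0 : \sum_j vpoly t x S j = 0.
  apply: v0; rewrite sp ltnS.
  rewrite (eq_bigr (fun j => 1 *: vpoly t x S j)) => [|j _]; last by rewrite scale1r.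
  exact: (size_vsum tU xS (fun=> 1)).
have := congr1 (horner^~ (t i)) v0; rewrite horner_sum horner0 (bigD1 i) //=.
rewrite big1 ?addr0 => [/eqP|j ji].
  rewrite horner_vpoly mulf_eq0 (negPf xi) /=.
  by rewrite (negPf (nodepolyD1_neq0 t_inj tU S i)).
by rewrite horner_vpoly nodepolyD1_root ?mulr0 // eq_sym.
Qed.

(* The constant that makes the two sides of interp_den agree at the node tn. *)
Let lam := (nodepoly t S).[tn] / q.[tn].

(* The value dictated by interp_den at the node t i. *)
Let u i := if i \in S then
    w i * q.[t i] * lam / ((t i - tn) * (nodepoly t (S :\ i)).[t i])
  else 0.

Let uS i : i \notin S -> u i = 0.
Proof. by rewrite /u => /negPf->. Qed.

Lemma lam_neq0 : lam != 0.
Proof.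
by rewrite mulf_neq0 ?invr_neq0 //; apply: nodepoly_neq0.
Qed.

Lemma lagrange_supp : [set i | u i != 0] = S.
Proof.
apply/setP => i; rewrite inE /u; case: ifP => [_|]; last by rewrite eqxx.
have w0 : w i != 0.
  by apply/eqP => wi; have /eqP := wU i; rewrite wi mul0r eq_sym oner_eq0.
have tin : t i - tn != 0 by rewrite subr_eq0 eq_sym.
have n0 := nodepolyD1_neq0 t_inj tU S i.
have q0 := qt i; move: lam lam_neq0 => l l0.
by rewrite !mulf_eq0 invr_eq0 mulf_eq0 !negb_or w0 q0 l0 tin n0.
Qed.

Lemma interp_node i : i \in S ->
  (t i - tn) * (vpoly t u S i).[t i] = lam * (w i * q.[t i]).
Proof.
move=> iS; rewrite horner_vpoly /u iS; move: lam => l.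
have n0 := nodepolyD1_neq0 t_inj tU S i.
have tin : t i - tn != 0 by rewrite subr_eq0 eq_sym.
move: (nodepoly _ _).[_] n0 => a a0.
by field; rewrite tin a0.
Qed.

Let nodes := tn :: [seq t i | i <- enum S].

Let nodes_uniq : uniq nodes.
Proof.
rewrite /= map_inj_uniq // enum_uniq andbT; apply/mapP => -[i _ /eqP].
by rewrite (negPf (tnt i)).
Qed.

Let size_nodes : size nodes = #|S|.+1.
Proof. by rewrite /= size_map cardE. Qed.

Lemma interp_num : numpoly t u tn wn S = lam *: p.
Proof.
apply: (poly_eq_nodes nodes_uniq); rewrite ?size_nodes.
- exact: size_numpoly.
- by rewrite (leq_trans (size_scale_leq _ _)) // sp.
- move=> z; rewrite inE => /orP[/eqP->|/mapP[j]].
    by rewrite numpoly_tn hornerZ ptn mulrCA divfK.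
  by rewrite mem_enum => jS ->; rewrite numpoly_node // hornerZ pt interp_node.
Qed.

Lemma interp_den : denpoly t w u tn S = lam *: q.
Proof.
apply: (poly_eq_nodes nodes_uniq); rewrite ?size_nodes.
- exact: size_denpoly.
- by rewrite (leq_trans (size_scale_leq _ _)).
- move=> z; rewrite inE => /orP[/eqP->|/mapP[j]].
    by rewrite denpoly_tn hornerZ divfK.
  rewrite mem_enum => jS ->; rewrite denpoly_node // hornerZ mulrCA.
  by rewrite interp_node //; ring: (wU j).
Qed.

(** The vector found by interpolation satisfies the linear system that
    determines the one attached to the Pick matrix. *)
Lemma interp_rel i : mxact P u i * (tn - t i) = wn - w i.
Proof.
have pE : p - wn *: q = ('X - tn%:P) * \sum_(g <- r) proj u g *: g.
  have n0 : nodepoly t S != 0 by rewrite -size_poly_eq0 size_nodepoly.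
  apply: (mulfI n0); rewrite mulrCA -gram_interp //.
  have eN : ('X - tn%:P) * (\sum_i vpoly t u S i) = lam *: p - wn *: nodepoly t S.
    by rewrite -interp_num /numpoly addrAC subrr add0r.
  have eD : ('X - tn%:P) * (\sum_i (w i)^* *: vpoly t u S i) =
            lam *: q - nodepoly t S.
    by rewrite -interp_den /denpoly addrAC subrr add0r.
  by rewrite [RHS]mulrBr !mulrA eN eD -!mul_polyC; ring.
have /= := congr1 (horner^~ (t i)) pE; rewrite !hornerE pt horner_sum => e.
rewrite mxact_grammx; have -> : (if i \notin S then delta * u i else 0) = 0.
  by case: ifP => // /uS->; rewrite mulr0.
rewrite addr0; apply: (mulIf (qt i)).
have -> : (\sum_(g <- r) feat g i * proj u g) * (tn - t i) * q.[t i] =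
  - ((t i - tn) * \sum_(g <- r) (proj u g *: g).[t i]).
  rewrite -[RHS]mulNr opprB mulrAC mulrC; congr (_ * _).
  rewrite mulr_suml; apply: eq_bigr => g _.
  by rewrite hornerZ /feat; field.
by rewrite -e; ring.
Qed.

Lemma gram_representation : exists2 v : 'I_m -> C,
  [set i | v i != 0] = S /\
  (forall i, mxact P v i * (tn - t i) = wn - w i) &
  exists2 l, l != 0 &
    numpoly t v tn wn S = l *: p /\ denpoly t w v tn S = l *: q.
Proof.
exists u; first by split; [exact: lagrange_supp|exact: interp_rel].
by exists lam; [exact: lam_neq0|split; [exact: interp_num|exact: interp_den]].
Qed.

End Converse.

(** * Derivatives of quotients of polynomials *)

Section QuotientDerivative.
Import numFieldNormedType.Exports.
Local Open Scope classical_set_scope.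
Variable K : numFieldType.
Implicit Types (p q r : {poly K}) (f : K -> K).

Let cst_cvg (c a : K) : c @[_ --> a] --> c.
Proof. by apply: (@cvg_cst K); exact: nbhs_filter. Qed.

Lemma horner_cvg p (a : K) : p.[x] @[x --> a] --> p.[a].
Proof.
elim/poly_ind: p => [|p c IH].
  have -> : (fun x => (0 : {poly K}).[x]) = cst 0.
    by apply/funext => x; rewrite horner0.
  by rewrite horner0; exact: cst_cvg.
have -> : (fun x : K => (p * 'X + c%:P).[x]) = (fun x => p.[x] * x + c).
  by apply/funext => x; rewrite hornerMXaddC.
rewrite hornerMXaddC.
have FF := nbhs_filter a.
exact: (@cvgD K K K _ FF _ _ _ _ (@cvgM K K _ FF _ _ _ _ IH cvg_id) (@cst_cvg c a)).
Qed.

(** If [p - v q = (z - a) r] and [q a != 0], then [p / q] has the value [v] and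
    the derivative [r a / q a] at [a]. *)
Lemma derive1_quotient f p q r (a v : K) : q.[a] != 0 ->
  (forall z, q.[z] != 0 -> f z = p.[z] / q.[z]) ->
  (forall z, (z - a) * r.[z] = p.[z] - v * q.[z]) ->
  derive1 f a = r.[a] / q.[a].
Proof.
move=> qa fE e; rewrite /derive1; apply/cvg_lim; first exact: norm_hausdorff.
have pa : p.[a] = v * q.[a].
  by apply/eqP; rewrite -subr_eq0 -e subrr mul0r.
have shift : (h + a) @[h --> (0 : K)] --> a.
  have FF := nbhs_filter (0 : K); rewrite -[X in _ --> X]add0r.
  exact: (@cvgD K K K _ FF _ _ _ _ cvg_id (@cst_cvg a 0)).
have lim : (r.[h + a] / q.[h + a]) @[h --> (0 : K)] --> r.[a] / q.[a].
  have FF := nbhs_filter (0 : K).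
  have rc := cvg_comp _ _ shift (@horner_cvg r a).
  have qc := cvg_comp _ _ shift (@horner_cvg q a).
  exact: (@cvgM K K _ FF _ _ _ _ rc (cvgV qa qc)).
have qn : \forall h \near (0 : K), q.[h + a] != 0.
  exact: (cvgr_neq0 _ (cvg_comp _ _ shift (@horner_cvg q a)) qa).
have lim' : (r.[h + a] / q.[h + a]) @[h --> (0 : K)^'] --> r.[a] / q.[a].
  exact: cvg_within_filter lim.
apply: cvg_trans lim'; apply: near_eq_cvg.
near=> h.
have h0 : h != 0 by near: h; exact: nbhs_dnbhs_neq.
have qh : q.[h + a] != 0 by near: h; apply: nbhs_dnbhs.
rewrite !fE // pa mulfK //; have := e (h + a); rewrite addrK => eh.
have -> : p.[h + a] = h * r.[h + a] + v * q.[h + a] by rewrite eh subrK.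
by rewrite mulrDl mulfK // addrK -mulrA [RHS]mulKf.
Unshelve. all: by end_near. Qed.

End QuotientDerivative.

(** * Rational functions *)

Section RationalFunctions.
Import numFieldNormedType.Exports.
Variable C : numClosedFieldType.
Local Notation "x %:F" := (FracField.tofrac x).
Implicit Types (p q r : {poly C}) (s : seq C).

Lemma ratC_X (a : C) : ratX C - ratC a = ('X - a%:P)%:F.
Proof. by rewrite tofracB. Qed.

Lemma one_sub_ratX (a : C) : 1 - ratX C * ratC a = (1 - a *: 'X)%:F.
Proof. by rewrite tofracB tofrac1 -mul_polyC tofracM mulrC. Qed.

(** Finite Blaschke products as quotients of two polynomials. *)
Lemma is_blaschkeP k (f : {fraction {poly C}}) : is_blaschke k f <->
  exists c s, [/\ `|c| = 1, size s = k, in_disk s &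
    f = (c *: blnum s)%:F / (blden s)%:F].
Proof.
have prodE (s : seq C) : \prod_(a <- s) ((ratX C - ratC a) / (1 - ratX C * ratC a^*)) =
  (blnum s)%:F / (blden s)%:F.
  rewrite prodf_div /blnum /blden !rmorph_prod /=.
  by congr (_ / _); apply: eq_bigr => a _; rewrite (ratC_X, one_sub_ratX).
split.
  move=> [c [a [c1 a1 ->]]]; exists c, [seq a i | i <- enum 'I_k]; split => //.
  - by rewrite size_map size_enum_ord.
  - by apply/allP => _ /mapP[i _ ->].
  - by rewrite -mul_polyC tofracM -mulrA -prodE big_map big_enum.
move=> [c [s [c1 <- sD ->]]]; exists c, (fun i => s`_i); split => //.
  by move=> i; apply: (allP sD); rewrite mem_nth.
rewrite -mul_polyC tofracM -mulrA -prodE (big_nth 0) big_mkord //.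
Qed.

(** The degree of a finite Blaschke product is determined by the function. *)
Lemma is_blaschke_inj j k (f : {fraction {poly C}}) :
  is_blaschke j f -> is_blaschke k f -> j = k.
Proof.
have half i l c c' s s' : `|c| = 1 -> `|c'| = 1 -> size s = i -> size s' = l ->
  in_disk s -> in_disk s' -> (c *: blnum s) * blden s' = (c' *: blnum s') * blden s ->
  (i <= l)%N.
  move=> c1 c'1 <- <- sD s'D e.
  have c0 : c != 0 by rewrite -normr_eq0 c1 oner_eq0.
  have c'0 : c' != 0 by rewrite -normr_eq0 c'1 oner_eq0.
  have : blnum s %| (c' *: blnum s') * blden s.
    by rewrite -e -scalerAl dvdpZr // dvdp_mulr.
  rewrite Gauss_dvdpl ?coprimep_blnum_blden // dvdpZr // => /dvdp_leq.
  by rewrite !size_blnum ltnS; apply; rewrite -size_poly_eq0 size_blnum.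
move=> /is_blaschkeP[c [s [c1 sj sD fE]]] /is_blaschkeP[c' [s' [c'1 sk s'D fE']]].
have := fE; rewrite fE' => /eqP.
rewrite eqr_div ?tofrac_eq0 ?blden_poly_neq0 // -!tofracM tofrac_eq => /eqP e.
apply/eqP; rewrite eqn_leq; apply/andP; split.
  exact: half c1 c'1 sj sk sD s'D (esym e).
exact: half c'1 c1 sk sj s'D sD e.
Qed.

Lemma rat_derivE p q r (a v : C) : q.[a] != 0 ->
  (forall z, (z - a) * r.[z] = p.[z] - v * q.[z]) ->
  rat_deriv (p%:F / q%:F) a = r.[a] / q.[a].
Proof.
move=> qa e; rewrite /rat_deriv; apply: derive1_quotient e => // z.
exact: rat_evalE.
Qed.

End RationalFunctions.

Section PartialFractions.
Variables (C : numClosedFieldType) (m : nat) (t : 'I_m -> C).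
Local Notation "x %:F" := (FracField.tofrac x).
Hypothesis tU : forall i, t i * (t i)^* = 1.
Variables (w u : 'I_m -> C) (tn wn : C) (S : {set 'I_m}).
Hypothesis uS : forall i, i \notin S -> u i = 0.

Lemma ratC1 : ratC (1 : C) = 1. Proof. exact: tofrac1. Qed.
Lemma ratCM (a b : C) : ratC (a * b) = ratC a * ratC b.
Proof. by rewrite /ratC polyCM tofracM. Qed.

(** The rational function [1 - t_i^* z]. *)
Definition ratnode i : {fraction {poly C}} := 1 - ratX C * ratC (t i)^*.

Lemma ratnode_neq0 i : ratnode i != 0.
Proof. by rewrite /ratnode one_sub_ratX tofrac_eq0 -size_poly_eq0 size_node_factor. Qed.

Lemma vpoly_tofrac i :
  (vpoly t u S i)%:F = (nodepoly t S)%:F * (ratC (u i) / ratnode i).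
Proof.
rewrite /vpoly -mul_polyC tofracM -/(ratC (u i)).
case: (boolP (i \in S)) => [iS|/uS->]; last first.
  by rewrite /ratC tofrac0 !mul0r mulr0.
have -> : nodepoly t S = (1 - (t i)^* *: 'X) * nodepoly t (S :\ i).
  rewrite /nodepoly (bigD1 i) //=; congr (_ * _).
  by apply: eq_bigl => j; rewrite !inE andbC.
rewrite tofracM -one_sub_ratX -/(ratnode i) [RHS]mulrC -mulrA.
by rewrite mulKf ?ratnode_neq0.
Qed.

Lemma numpoly_tofrac : (numpoly t u tn wn S)%:F = (nodepoly t S)%:F *
  (ratC wn + (ratX C - ratC tn) * \sum_i ratC (u i) / ratnode i).
Proof.
rewrite /numpoly tofracD -mul_polyC !tofracM -ratC_X rmorph_sum mulrDr /=.
rewrite [ratC wn]/ratC [RHS]addrC [LHS]addrC [X in _ = _ + X]mulrC; congr (_ + _).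
rewrite mulrCA; congr (_ * _); rewrite mulr_sumr.
by apply: eq_bigr => i _; rewrite vpoly_tofrac.
Qed.

Lemma denpoly_tofrac : (denpoly t w u tn S)%:F = (nodepoly t S)%:F *
  (1 + (ratX C - ratC tn) * \sum_i ratC ((w i)^* * u i) / ratnode i).
Proof.
rewrite /denpoly tofracD !tofracM -ratC_X rmorph_sum mulrDr mulr1 /=.
congr (_ + _); rewrite mulrCA; congr (_ * _); rewrite mulr_sumr.
apply: eq_bigr => i _; rewrite -mul_polyC tofracM vpoly_tofrac ratCM.
by rewrite -/(ratC _) -!mulrA mulrCA.
Qed.

End PartialFractions.

(** * Diagonal and positive definite matrices *)

Section MatrixTools.

Lemma invmx_diag (F : fieldType) n (d : 'rV[F]_n) : (forall i, d 0 i != 0) ->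
  diag_mx d \in unitmx /\ invmx (diag_mx d) = diag_mx (map_mx GRing.inv d).
Proof.
move=> d0; have e : diag_mx d *m diag_mx (map_mx GRing.inv d) = 1%:M.
  rewrite mulmx_diag -diag_const_mx; congr diag_mx; apply/rowP => i.
  by rewrite !mxE divff.
have [uD _] := mulmx1_unit e; split => //.
by rewrite -[RHS](mulKmx uD) e mulmx1.
Qed.

Lemma affine_sum_num (F : fieldType) n (d v : F) (a b : 'I_n -> F) :
  (1 + d * \sum_i a i) * v + d * (\sum_i b i) = v + d * \sum_i (a i * v + b i).
Proof. by rewrite big_split -mulr_suml /=; ring. Qed.

Lemma affine_sum_den (F : fieldType) n (d v : F) (a b : 'I_n -> F) :
  d * (\sum_i a i) * v + (1 + d * \sum_i b i) = 1 + d * \sum_i (a i * v + b i).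
Proof. by rewrite big_split -mulr_suml /=; ring. Qed.

Lemma frac_comb (F : fieldType) (x y a b v : F) :
  x / y * a * v + x / y * b = x * (a * v + b) / y.
Proof. by ring. Qed.

Variable C : numClosedFieldType.

Lemma mxform_mulmx n (P : 'M[C]_n) (v : 'cV[C]_n) :
  (map_mx Num.conj v^T *m P *m v) ord0 ord0 =
  mxform P (fun i => v i ord0) (fun i => v i ord0).
Proof.
rewrite -mulmxA mxE; apply: eq_bigr => i _; rewrite !mxE.
by congr (_ * _); apply: eq_bigr.
Qed.

Lemma posdefmxP n (P : 'M[C]_n) :
  posdefmx P <-> (forall i j, P j i = (P i j)^*) /\ pos_form P.
Proof.
split=> [[/is_hermitianmxP PE Pp]|[PH Pp]]; split.
- by move=> i j; rewrite {1}PE expr0 scale1r !mxE.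
- move=> x i xi; have := Pp (\col_j x j); rewrite mxform_mulmx.
  rewrite (_ : mxform P _ _ = mxform P x x); last first.
    apply: eq_bigr => j _; rewrite mxE; congr (_ * _).
    by apply: eq_bigr => k _; rewrite mxE.
  by apply; apply: contra xi => /eqP/colP/(_ i); rewrite !mxE => ->.
- apply/is_hermitianmxP; rewrite expr0 scale1r; apply/matrixP => i j.
  by rewrite !mxE -PH.
- move=> v v0; rewrite mxform_mulmx.
  have [i vi] : exists i, v i ord0 != 0.
    by move: v0 => /cV0Pn.
  exact: (Pp _ i vi).
Qed.

Lemma pos_form_unit n (P : 'M[C]_n) : pos_form P -> P \in unitmx.
Proof.
move=> Pp; rewrite -row_free_unit; apply: inj_row_free => v vP.
apply/eqP; apply/negPn/negP => /rV0Pn [i vi].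
have := Pp (fun j => (v 0 j)^*) i; rewrite conjC_eq0 => /(_ vi).
rewrite /mxform /mxact; under eq_bigr do rewrite conjCK mulr_sumr.
rewrite exchange_big big1 ?ltxx //= => j _.
have /rowP/(_ j) := vP; rewrite !mxE => e.
transitivity ((\sum_k v 0 k * P k j) * (v 0 j)^*); last by rewrite e mul0r.
by rewrite mulr_suml; apply: eq_bigr => k _; rewrite mulrA.
Qed.

End MatrixTools.

(** * The functions [fgamma] *)

Section Interpolants.
Local Open Scope sesquilinear_scope.
Variables (R : realType) (m : nat) (t w : 'I_m.+1 -> R[i]).
Hypothesis t_inj : injective t.
Hypothesis t_unit : forall i, `|t i| = 1.
Hypothesis w_unit : forall i, `|w i| = 1.
Local Notation C := (R[i]).
Local Notation "x %:F" := (FracField.tofrac x).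
Local Notation tn := (t ord_max).
Local Notation wn := (w ord_max).
Local Notation th := (fun i : 'I_m => t (head_node i)).
Local Notation wh := (fun i : 'I_m => w (head_node i)).
Implicit Type gam : m.-tuple R.

Let unit_conj (x : C) : `|x| = 1 -> x * x^* = 1.
Proof. by move=> x1; rewrite -normCK x1 expr1n. Qed.

Let tU i : th i * (th i)^* = 1. Proof. exact: unit_conj. Qed.
Let wU i : wh i * (wh i)^* = 1. Proof. exact: unit_conj. Qed.
Let tnU : tn * tn^* = 1. Proof. exact: unit_conj. Qed.
Let wnU : wn * wn^* = 1. Proof. exact: unit_conj. Qed.
Let th_inj : injective th.
Proof. by move=> i j /t_inj/lift_inj. Qed.
Let tnt i : tn != th i.
Proof.
by apply/eqP => /t_inj e; have := neq_lift ord_max i; rewrite -/(head_node i) -e eqxx.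
Qed.

(** The vector [u = P^-1 (tn - T)^-1 (wn E - M)]. *)
Definition ugamma gam (i : 'I_m) : C :=
  (invmx (Pgamma t w gam) *m invmx (tn%:M - Tmx t) *m (wn *: Ecol R m - Mcol w)) i ord0.

Lemma tn_Tmx : tn%:M - Tmx t = diag_mx (\row_i (tn - th i)).
Proof.
rewrite -diag_const_mx -raddfB; congr diag_mx; apply/rowP => i.
by rewrite !mxE.
Qed.

Lemma tn_Tmx_unit : tn%:M - Tmx t \in unitmx.
Proof.
rewrite tn_Tmx; apply: (proj1 (invmx_diag _)) => i.
by rewrite mxE subr_eq0 tnt.
Qed.

(** The linear system [(tn - T) P u = wn E - M], entry by entry. *)
Lemma Pgamma_rel gam (u : 'I_m -> C) : Pgamma t w gam \in unitmx ->
  (forall i, mxact (Pgamma t w gam) u i * (tn - th i) = wn - wh i) <->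
  u =1 ugamma gam.
Proof.
move=> uP; set P := Pgamma t w gam.
have actE (v : 'cV[C]_m) i : mxact P (fun j => v j ord0) i = (P *m v) i ord0.
  by rewrite mxE.
have diagE (v : 'cV[C]_m) i : ((tn%:M - Tmx t) *m v) i ord0 = v i ord0 * (tn - th i).
  by rewrite tn_Tmx mul_diag_mx !mxE mulrC.
have rhsE i : (wn *: Ecol R m - Mcol w) i ord0 = wn - wh i.
  by rewrite !mxE mulr1.
split=> [uE i|uE i]; last first.
  have -> : mxact P u i =
      mxact P (fun j => (invmx P *m (invmx (tn%:M - Tmx t) *m
        (wn *: Ecol R m - Mcol w))) j ord0) i.
    by apply: eq_bigr => j _; rewrite uE /ugamma mulmxA.
  by rewrite actE mulKVmx // -diagE mulKVmx ?tn_Tmx_unit // rhsE.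
have : (tn%:M - Tmx t) *m (P *m (\col_j u j)) = wn *: Ecol R m - Mcol w.
  apply/colP => j; rewrite diagE -actE rhsE -uE; congr (_ * _).
  by apply: eq_bigr => k _; rewrite mxE.
rewrite /ugamma -mulmxA => <-; rewrite mulKmx ?tn_Tmx_unit // mulKmx //.
by rewrite mxE.
Qed.

Lemma xgamma_ygamma gam i :
  (xgamma t w gam i * wn == ygamma t w gam i) = (ugamma gam i == 0).
Proof.
have n0 : 1 - tn * (th i)^* != 0 by rewrite (node_factor_eq0 tU).
rewrite -subr_eq0 /xgamma /ygamma.
set A := invmx _ *m invmx _.
have -> : ugamma gam i = (A *m Ecol R m) i ord0 * wn - (A *m Mcol w) i ord0.
  by rewrite /ugamma -/A mulmxBr -scalemxAr;
     move: (A *m _) (A *m _) => a b; rewrite !mxE mulrC.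
rewrite -mulrA -mulrBr mulf_eq0.
by rewrite (negPf n0).
Qed.

(** The two columns of the block matrix, indexed in ['I_2]. *)
Lemma row_mx_cols (F : Type) n (A B : 'cV[F]_n) i :
  (row_mx A B : 'M[F]_(n, 2)) i 0 = A i 0 /\ (row_mx A B : 'M[F]_(n, 2)) i 1 = B i 0.
Proof.
split.
  have -> : (0 : 'I_2) = lshift 1 (0 : 'I_1) by exact: val_inj.
  exact: row_mxEl.
have -> : (1 : 'I_2) = rshift 1 (0 : 'I_1) by exact: val_inj.
exact: row_mxEr.
Qed.

Lemma col_mx_rows (F : Type) n (A B : 'rV[F]_n) i :
  (col_mx A B : 'M[F]_(2, n)) 0 i = A 0 i /\ (col_mx A B : 'M[F]_(2, n)) 1 i = B 0 i.
Proof.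
split.
  have -> : (0 : 'I_2) = lshift 1 (0 : 'I_1) by exact: val_inj.
  exact: col_mxEu.
have -> : (1 : 'I_2) = rshift 1 (0 : 'I_1) by exact: val_inj.
exact: col_mxEd.
Qed.

Let Bmx gam : 'M[C]_(m, 2) := invmx (Pgamma t w gam) *m
  invmx (tn%:M - Tmx t) *m row_mx (Ecol R m) (- Mcol w).
Let EMmx : 'M[C]_(2, m) := col_mx ((Ecol R m) ^t*) ((Mcol w) ^t*).

Lemma usol_Bmx gam i : ugamma gam i = Bmx gam i 0 * wn + Bmx gam i 1.
Proof.
rewrite /Bmx mul_mx_row !(proj1 (row_mx_cols _ _ _)) !(proj2 (row_mx_cols _ _ _)).
by rewrite /ugamma mulmxBr -scalemxAr mulmxN; move: (_ *m _) (_ *m _) => a b;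
   rewrite !mxE mulrC.
Qed.

Lemma resolvent_inv :
  invmx (1%:M - ratX C *: map_mx (@ratC C) ((Tmx t) ^t*)) =
  diag_mx (\row_i (ratnode th i)^-1).
Proof.
have -> : 1%:M - ratX C *: map_mx (@ratC C) ((Tmx t) ^t*) =
    diag_mx (\row_i ratnode th i).
  apply/matrixP => i j; rewrite !mxE eq_sym; case: eqP => [->|_].
    by rewrite !mulr1n.
  by rewrite !mulr0n conjC0 /ratC tofrac0 mulr0 subrr.
have [|_ ->] := @invmx_diag _ _ (\row_i ratnode th i).
  by move=> i; rewrite mxE ratnode_neq0.
by congr diag_mx; apply/rowP => i; rewrite !mxE.
Qed.

Lemma ThetaE gam a b : Theta t w gam a b =
  (a == b)%:R + (ratX C - ratC tn) *
    \sum_i ratC (EMmx a i) / ratnode th i * ratC (Bmx gam i b).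
Proof.
rewrite /Theta resolvent_inv -/(Bmx gam) -/EMmx.
rewrite [in LHS]mxE [1%:M a b]mxE; congr (_ + _).
rewrite [in LHS]mxE; congr (_ * _); rewrite [in LHS]mxE; apply: eq_bigr => i _.
rewrite mul_mx_diag [map_mx _ _ i b]mxE; congr (_ * _); rewrite mxE.
by rewrite [map_mx _ _ a i]mxE; congr (_ * _); rewrite mxE.
Qed.

Lemma EMmx0 i : EMmx 0 i = 1.
Proof. by rewrite (proj1 (col_mx_rows _ _ _)) !mxE conjC1. Qed.
Lemma EMmx1 i : EMmx 1 i = (wh i)^*.
Proof. by rewrite (proj2 (col_mx_rows _ _ _)) !mxE. Qed.

Let ent gam a b : {fraction {poly C}} :=
  \sum_i ratC (EMmx a i) / ratnode th i * ratC (Bmx gam i b).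

Lemma Theta_diag gam a :
  Theta t w gam a a = 1 + (ratX C - ratC tn) * ent gam a a.
Proof. by rewrite ThetaE eqxx. Qed.

Lemma Theta_offdiag gam a b : (a == b) = false ->
  Theta t w gam a b = (ratX C - ratC tn) * ent gam a b.
Proof. by move=> ab; rewrite ThetaE ab mulr0n add0r. Qed.

Lemma ratCD (x y : C) : ratC (x + y) = ratC x + ratC y.
Proof. by rewrite /ratC polyCD tofracD. Qed.

Lemma ent0 gam i :
  ratC (EMmx 0 i) / ratnode th i * ratC (Bmx gam i 0) * ratC wn +
    ratC (EMmx 0 i) / ratnode th i * ratC (Bmx gam i 1) =
  ratC (ugamma gam i) / ratnode th i.
Proof. by rewrite frac_comb EMmx0 ratC1 mul1r usol_Bmx ratCD ratCM. Qed.

Lemma ent1 gam i :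
  ratC (EMmx 1 i) / ratnode th i * ratC (Bmx gam i 0) * ratC wn +
    ratC (EMmx 1 i) / ratnode th i * ratC (Bmx gam i 1) =
  ratC ((wh i)^* * ugamma gam i) / ratnode th i.
Proof. by rewrite frac_comb EMmx1 usol_Bmx ratCM ratCD ratCM. Qed.

(** Partial fraction expansions of the numerator and denominator. *)
Lemma fgamma_partial gam : fgamma t w gam =
  (ratC wn + (ratX C - ratC tn) * \sum_i ratC (ugamma gam i) / ratnode th i) /
  (1 + (ratX C - ratC tn) *
     \sum_i ratC ((wh i)^* * ugamma gam i) / ratnode th i).
Proof.
have e01 : ((0 : 'I_2) == 1) = false by [].
have e10 : ((1 : 'I_2) == 0) = false by [].
rewrite /fgamma (Theta_diag gam 0) (Theta_diag gam 1).
rewrite (Theta_offdiag gam e01) (Theta_offdiag gam e10).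
rewrite affine_sum_num affine_sum_den.
by rewrite (eq_bigr _ (fun i _ => ent0 gam i)) (eq_bigr _ (fun i _ => ent1 gam i)).
Qed.

Let supp gam : {set 'I_m} := [set i | ugamma gam i != 0].

(** The poles of both expansions at the nodes cancel. *)
Lemma fgamma_polys gam : fgamma t w gam =
  (numpoly th (ugamma gam) tn wn (supp gam))%:F /
  (denpoly th wh (ugamma gam) tn (supp gam))%:F.
Proof.
have uS i : i \notin supp gam -> ugamma gam i = 0 by rewrite inE negbK => /eqP.
rewrite (numpoly_tofrac tU tn wn uS) (denpoly_tofrac tU wh tn uS) fgamma_partial.
rewrite -mulf_div divff ?mul1r // tofrac_eq0 -size_poly_eq0.
by rewrite size_nodepoly.
Qed.

Lemma Pgamma_stein gam i j : Pgamma t w gam i j * (1 - th i * (th j)^*) =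
  1 - wh i * (wh j)^*.
Proof.
rewrite mxE; case: (eqVneq i j) => [->|ij].
  by rewrite tU wU !subrr mulr0.
by rewrite divfK // (node_factor_eq0 tU) (inj_eq th_inj).
Qed.

(** The indices counted by [l]. *)
Definition xyset gam : {set 'I_m} :=
  [set i | xgamma t w gam i * wn == ygamma t w gam i].

Lemma card_supp_ugamma gam : (m - #|xyset gam|)%N = #|supp gam|.
Proof.
have -> : xyset gam = ~: supp gam.
  by apply/setP => i; rewrite !inE negbK xgamma_ygamma.
by rewrite -[X in (X - _)%N](card_ord m) -(cardsC (supp gam)) addnK.
Qed.

Section Admissible.
Variable gam : m.-tuple R.
Hypothesis gam_adm : admissible t w gam.

Let Pherm i j : Pgamma t w gam j i = (Pgamma t w gam i j)^*.
Proof. by case: gam_adm => _ /posdefmxP[]. Qed.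
Let Ppos : pos_form (Pgamma t w gam).
Proof. by case: gam_adm => _ /posdefmxP[]. Qed.
Let Pu i : mxact (Pgamma t w gam) (ugamma gam) i * (tn - th i) = wn - wh i.
Proof. by apply: (proj2 (Pgamma_rel _ (pos_form_unit Ppos))). Qed.

Lemma fgamma_blaschke : is_blaschke (m - #|xyset gam|) (fgamma t w gam).
Proof.
rewrite card_supp_ugamma fgamma_polys; apply/is_blaschkeP.
have [c [d [s [c1 d0 [ss sD] -> ->]]]] :=
  forward_blaschke th_inj tU tnU wnU tnt (Pgamma_stein gam) Pherm Ppos Pu.
exists c, s; split => //.
have d0F : d%:P%:F != 0 :> {fraction {poly C}}.
  by rewrite tofrac_eq0 polyC_eq0.
rewrite [c * d]mulrC -scalerA -[d *: _]mul_polyC -[d *: blden s]mul_polyC !tofracM.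
by rewrite -mulf_div divff // mul1r.
Qed.

Let den_neq0 z : `|z| = 1 ->
  (denpoly th wh (ugamma gam) tn (supp gam)).[z] != 0.
Proof.
exact: (denpoly_unit_neq0 th_inj tU tnU wnU tnt (Pgamma_stein gam) Pherm Ppos Pu).
Qed.

Lemma fgamma_interp i : rat_eval (fgamma t w gam) (t i) = w i.
Proof.
rewrite fgamma_polys rat_evalE; last exact: den_neq0.
have d0 := den_neq0 (t_unit i); apply: (canLR (mulfK d0)).
move: d0; case: (unliftP ord_max i) => [j ->|->] _.
  exact: (numpoly_interp (Pgamma_stein gam) Pu).
by rewrite numpoly_tn denpoly_tn.
Qed.

Lemma fgamma_deriv i : rat_deriv (fgamma t w gam) (th i) =
  slope th wh (ugamma gam) tn (Pgamma t w gam) i.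
Proof.
rewrite fgamma_polys (rat_derivE (v := wh i)
  (r := slope_poly th (ugamma gam) tn (Pgamma t w gam) i)) //.
- exact: den_neq0.
- move=> z; exact: (resolvent_horner (Pgamma_stein gam) Pu).
Qed.

Let PiiE i : Pgamma t w gam i i = ((tnth gam i)%:C)%C.
Proof. by rewrite mxE eqxx. Qed.

Lemma fgamma_deriv_eq i : ugamma gam i != 0 ->
  `|rat_deriv (fgamma t w gam) (th i)| = ((tnth gam i)%:C)%C.
Proof.
move=> ui; rewrite fgamma_deriv.
rewrite (slope_supp th_inj tU wU tnU wnU tnt (Pgamma_stein gam) Pherm Ppos Pu ui).
rewrite PiiE !normrM norm_conjC t_unit w_unit !mul1r ger0_norm //.
by rewrite ler0c ltW //; case: gam_adm.
Qed.

Lemma fgamma_deriv_lt i : ugamma gam i = 0 ->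
  `|rat_deriv (fgamma t w gam) (th i)| < ((tnth gam i)%:C)%C.
Proof.
move=> ui; rewrite fgamma_deriv -PiiE.
exact: (slope_off th_inj tU wU tnU wnU tnt (Pgamma_stein gam) Pherm Ppos Pu ui).
Qed.

End Admissible.

(** A Blaschke product of degree [k] through all the nodes is represented by a
    tuple for each choice of [k] nodes and each [delta > 0]. *)
Lemma blaschke_representation k (f : {fraction {poly C}}) (S : {set 'I_m}) :
  is_blaschke k f -> #|S| = k -> (forall i, rat_eval f (t i) = w i) ->
  exists D : 'I_m -> R, forall delta : R, 0 < delta ->
    let gam := [tuple D i + (if i \notin S then delta else 0) | i < m] in
    admissible t w gam /\ f = fgamma t w gam.
Proof.
move=> /is_blaschkeP[c [s [c1 sk sD fE]]] Sk fI.
pose p := c *: blnum s; pose q := blden s; rewrite -/p -/q in fE.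
have qz z : `|z| = 1 -> q.[z] != 0 by move=> z1; rewrite blden_neq0 // z1.
have pz i : p.[t i] = w i * q.[t i].
  by have := fI i; rewrite fE rat_evalE ?qz // => <-; rewrite divfK ?qz.
have c0 : c != 0 by rewrite -normr_eq0 c1 oner_eq0.
have sp : size p = #|S|.+1 by rewrite size_scale // size_blnum sk Sk.
have sq : (size q <= #|S|.+1)%N by rewrite Sk -sk size_blden.
have cpq : coprimep p q by rewrite coprimepZl // coprimep_blnum_blden.
have [r rE] := blaschke_gram sD.
have gram z z' : q.[z] * q.[z']^* - p.[z] * p.[z']^* =
    (1 - z * z'^*) * \sum_(g <- r) g.[z] * g.[z']^*.
  rewrite -rE /p !hornerZ rmorphM /= mulrACA (unit_conj c1) mul1r //.
pose DC i : C := \sum_(g <- r) feat th q g i * (feat th q g i)^*.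
have DC0 i : 0 <= DC i.
  by apply: sumr_ge0 => g _; rewrite -normCK exprn_ge0.
exists (fun i => complex.Re (DC i)) => delta delta0 gam.
have delta0C : 0 < (delta%:C)%C by rewrite (ltcR 0).
have DCE i : ((complex.Re (DC i))%:C)%C = DC i by rewrite RRe_real // ger0_real.
have PE : Pgamma t w gam = grammx th q r S (delta%:C)%C.
  apply/matrixP => i j; have [<-|ij] := eqVneq i j.
    rewrite !mxE eqxx tnth_mktuple /= rmorphD /= DCE; congr (_ + _).
    by case: ifP.
  have n0 : 1 - th i * (th j)^* != 0.
    by rewrite (node_factor_eq0 tU) (inj_eq th_inj).
  apply: (mulIf n0); rewrite Pgamma_stein.
  symmetry; exact: (grammx_stein S (delta%:C)%C tU wU
    (fun i => qz _ (t_unit _)) (fun i => pz _) gram).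
have Ppos : pos_form (Pgamma t w gam).
  rewrite PE; exact: (grammx_pos th_inj tU sp cpq (fun i => qz _ (t_unit _))
    (fun i => pz _) gram delta0C).
have adm : admissible t w gam.
  split; last first.
    apply/posdefmxP; split => // i j; rewrite !mxE eq_sym.
    case: ifP => [/eqP->|_]; first by rewrite conj_Creal // complex_real.
    rewrite fmorph_div !rmorphB !rmorphM /= !rmorph1 !conjCK.
    by rewrite [_ * w _]mulrC [_ * t _]mulrC.
  move=> i; have := Ppos (fun j => (j == i)%:R) i.
  rewrite eqxx oner_eq0 => /(_ isT).
  rewrite /mxform (bigD1 i) //= eqxx conjC1 mul1r big1 ?addr0 => [|j /negPf->].
    rewrite /mxact (bigD1 i) //= eqxx mulr1 big1 ?addr0 => [|j /negPf->].
      by rewrite mxE eqxx (ltcR 0).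
    by rewrite mulr0.
  by rewrite conjC0 mul0r.
split => //.
have [v [vS vP] [l l0 [nE dE]]] := gram_representation (delta%:C)%C
  th_inj tU wU tnt sp sq (fun i => qz _ (t_unit _))
  (qz _ (t_unit _)) (fun i => pz _) (pz ord_max) gram.
have vu : v =1 ugamma gam.
  by apply: (proj1 (Pgamma_rel v (pos_form_unit Ppos))); rewrite PE.
have uE : ugamma gam = v by apply/funext => i; rewrite vu.
have SE : supp gam = S by rewrite -vS /supp uE.
have lF : l%:P%:F != 0 :> {fraction {poly C}} by rewrite tofrac_eq0 polyC_eq0.
rewrite fgamma_polys SE uE nE dE fE -[l *: p]mul_polyC -[l *: q]mul_polyC.
by rewrite !tofracM -mulf_div divff // mul1r.
Qed.

Lemma blaschke_top_degree gam i : admissible t w gam ->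
  is_blaschke m (fgamma t w gam) -> ugamma gam i != 0.
Proof.
move=> adm fB; have := is_blaschke_inj fB (fgamma_blaschke adm).
rewrite card_supp_ugamma => mS; have : i \in supp gam.
  have /eqP : supp gam = [set: 'I_m].
    by apply/eqP; rewrite eqEcard finset.subsetT cardsT card_ord -mS leqnn.
  by move=> /eqP ->; rewrite inE.
by rewrite inE.
Qed.

End Interpolants.

Unset Implicit Arguments.

Theorem theorem3p5 (R : realType) (m : nat) (t w : 'I_m.+1 -> R[i])
    (t_inj : injective t)
    (t_unit : forall i, `|t i| = 1) (w_unit : forall i, `|w i| = 1) :
  (forall gam : m.-tuple R, admissible t w gam ->
    [/\ (exists k : nat, is_blaschke k (fgamma t w gam)) /\
        (forall i : 'I_m.+1, rat_eval (fgamma t w gam) (t i) = w i),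
        (forall i : 'I_m,
          `|rat_deriv (fgamma t w gam) (t (head_node i))|
             <= ((tnth gam i)%:C)%C /\
          (`|rat_deriv (fgamma t w gam) (t (head_node i))|
             = ((tnth gam i)%:C)%C
           <-> xgamma t w gam i * w ord_max <> ygamma t w gam i))
      & is_blaschke
          (m - #|[set i : 'I_m |
                    xgamma t w gam i * w ord_max == ygamma t w gam i]|)
          (fgamma t w gam)])
  /\
  (forall f : {fraction {poly R[i]}},
    is_blaschke_le m f ->
    (forall i : 'I_m.+1, rat_eval f (t i) = w i) ->
    (exists gam : m.-tuple R, admissible t w gam /\ f = fgamma t w gam) /\
    ((exists! gam : m.-tuple R, admissible t w gam /\ f = fgamma t w gam)
       <-> is_blaschke m f)).
Proof.
split=> [gam adm|f [k km fB] fI].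
  have fB := fgamma_blaschke t_inj t_unit w_unit adm.
  split => //; first split.
  - by exists (m - #|xyset t w gam|)%N.
  - exact: fgamma_interp.
  - move=> i; have xyE := xgamma_ygamma w t_inj t_unit gam i.
    have [u0|u0] := eqVneq (ugamma t w gam i) 0.
      have lt := fgamma_deriv_lt t_inj t_unit w_unit adm u0.
      split; first exact: ltW.
      split=> [e|/eqP]; first by rewrite e ltxx in lt.
      by rewrite xyE u0 eqxx.
    rewrite (fgamma_deriv_eq t_inj t_unit w_unit adm u0); split => //.
    by split => // _; apply/eqP; rewrite xyE.
(* Any set of k nodes serves; the first k are taken. *)
pose S := [set widen_ord km i | i : 'I_k].
have Sk : #|S| = k.
  by rewrite card_imset ?card_ord // => i j /(congr1 val) /= /val_inj.
have [D DP] := blaschke_representation t_inj t_unit w_unit fB Sk fI.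
split; first by eexists; exact: DP 1 ltr01.
split=> [[gam [_ gamU]]|fBm].
  suff -> : m = k by [].
  apply/eqP; rewrite eqn_leq km andbT leqNgt; apply/negP => ltkm.
  pose i := Ordinal ltkm.
  have iS : i \notin S.
    by apply/imsetP => -[j _ /(congr1 val) /= e]; have := ltn_ord j; rewrite -e ltnn.
  have := etrans (esym (gamU _ (DP 1 ltr01))) (gamU _ (DP 2%:R (ltr0Sn _ 1))).
  move=> /(congr1 (fun x => tnth x i)); rewrite !tnth_mktuple iS => /addrI/eqP.
  by rewrite -[1]/(1%:R) eqr_nat.
have [adm fE] := DP 1 ltr01; eexists; split; first by split; [exact: adm|].
move=> gam' [adm' fE']; apply: eq_from_tnth => i; apply: complexI.
have usol0 gam : admissible t w gam -> f = fgamma t w gam -> ugamma t w gam i != 0.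
  by move=> a e; apply: blaschke_top_degree; rewrite -?e.
rewrite -(fgamma_deriv_eq t_inj t_unit w_unit adm (usol0 _ adm fE)).
by rewrite -(fgamma_deriv_eq t_inj t_unit w_unit adm' (usol0 _ adm' fE')) -fE -fE'.
Qed.
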